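(* Let $\epsilon\in(0,1)$. Consider the message passing model on a connected undirected graph $G$ with $m$ vertices and diameter $d$, with a designated central vertex $\mathcal{C}$ (a vertex of minimum eccentricity), where each player $i$ is given $X_i \in \{0,1,\dots,M\}^{n\times t_1}$ and $Y_i \in \{0,1,\dots,M\}^{n\times t_2}$, and $\mathcal{X}=\sum_{i=1}^m X_i$, $\mathcal{Y}=\sum_{i=1}^m Y_i$. There is a protocol which outputs, at $\mathcal{C}$, a matrix $R \in \mathbb{R}^{t_1\times t_2}$ such that with probability $3/4$, \[ \|R - \mathcal{X}^T\mathcal{Y}\|_F \leq \epsilon \|\mathcal{X}\|_F\|\mathcal{Y}\|_F. \] The max communication required by the protocol is $O\!\left(\epsilon^{-2}(t_1+t_2)(\log\log n + \log(1/\epsilon) + \log d)\right)$.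
   Context: $\|A\|_F = (\sum_{i,j}A_{i,j}^2)^{1/2}$ is the Frobenius norm. Message passing model: there are $m$ players, one at each vertex of a connected undirected graph $G$ known to all players; player $i$ receives only its inputs; a player may send a message only to a neighbor in $G$, received only by that neighbor; the players share a public random string. Max communication is the maximum number of bits sent across any single edge. Standing assumption: $m, M = O(n^{c})$ for a constant $c$, so $\log(nmM)=O(\log n)$. *)

(* Defs.v *)
From mathcomp Require Import all_boot all_order all_algebra.
From mathcomp Require Import reals exp.

Set Implicit Arguments.
Unset Strict Implicit.
Unset Printing Implicit Defensive.

Import Order.TTheory GRing.Theory Num.Theory.

Section Graph.
Variables (m : nat) (G : rel 'I_m).

Definition simple_graph := symmetric G /\ irreflexive G.

Definition connected_graph := forall u v, connect G u v.

(* Shortest walks have fewer than m edges; the value is m if v is unreachable. *)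
Definition dist (u v : 'I_m) : nat :=
  find (fun k => [exists p : k.-tuple 'I_m, path G u p && (last u p == v)])
       (iota 0 m).

Definition ecc (u : 'I_m) : nat := \max_(v < m) dist u v.

Definition diameter : nat := \max_(u < m) ecc u.

Definition central (u : 'I_m) := forall v, ecc u <= ecc v.

End Graph.

(* The sequence of transmissions is fixed in advance and every message is a
   nonempty bit string, so that neither silence nor timing can carry information
   free of charge.  The list of bit strings passed to msg and out consists of
   the messages received so far by the sender of the k-th slot, respectively by
   the player producing the output; as the slots are public, the player knows
   the origin of each of them. *)
Record protocol (m : nat) (G : rel 'I_m) (input output : Type) := Protocol {
  coins : nat;
  slots : seq ('I_m * 'I_m);  (* (sender, receiver) *)
  msg : nat -> input -> coins.-tuple bool -> seq (seq bool) -> seq bool;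
  out : input -> coins.-tuple bool -> seq (seq bool) -> output;
  slots_edge : all (fun a => G a.1 a.2) slots;
  msg_nonempty : forall k x w r, msg k x w r != [::]
}.

Section Execution.
Variables (m : nat) (G : rel 'I_m) (input output : Type).
Variable (P : protocol G input output).

Definition transcript := seq (('I_m * 'I_m) * seq bool).

Definition received (v : 'I_m) (h : transcript) : seq (seq bool) :=
  [seq a.2 | a <- h & a.1.2 == v].

Variables (x : 'I_m -> input) (w : (coins P).-tuple bool).

Definition step (h : transcript) (a : 'I_m * 'I_m) : transcript :=
  rcons h (a, msg (size h) (x a.1) w (received a.1 h)).

Definition run : transcript := foldl step [::] (slots P).

Definition output_at (v : 'I_m) : output := out (x v) w (received v run).

(* Both directions of an edge are counted together. *)
Definition edge_bits (u v : 'I_m) : nat :=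
  \sum_(a <- run | (a.1 == (u, v)) || (a.1 == (v, u))) size a.2.

Definition max_comm : nat := \max_(b : 'I_m * 'I_m | G b.1 b.2) edge_bits b.1 b.2.

End Execution.

Local Open Scope ring_scope.

Section Real.
Variable R : realType.

Definition uniform_prob (L : nat) (E : pred (L.-tuple bool)) : R :=
  #|[set w | E w]|%:R / 2 ^+ L.

Definition frobenius (a b : nat) (A : 'M[R]_(a, b)) : R :=
  Num.sqrt (\sum_i \sum_j A i j ^+ 2).

(* The entries are summed in R, not in the ring of integers modulo M.+1. *)
Definition sum_inputs (m M a b : nat) (X : 'I_m -> 'M['I_M.+1]_(a, b)) : 'M[R]_(a, b) :=
  \sum_(i < m) map_mx (fun z : 'I_M.+1 => (nat_of_ord z)%:R) (X i).

End Real.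

(* Main.v *)
Require Import Defs.
From mathcomp Require Import all_boot all_order all_algebra.
From mathcomp Require Import reals exp.
From mathcomp Require Import zify ring lra.

Set Implicit Arguments.
Unset Strict Implicit.
Unset Printing Implicit Defensive.

Import Order.TTheory GRing.Theory Num.Theory.

(** Let S be a k x n matrix of random signs with k of order 1/eps^2.  Then
    (S X)^T (S Y) / k approximates X^T Y with relative Frobenius error O(eps), by a
    second moment computation.  The sums S X = sum_i S X_i and S Y = sum_i S Y_i are
    accumulated along a breadth-first tree of the graph towards the center, and at
    each hop every entry, an integer, is rounded to a floating-point number q * 2^j
    with log(d/eps) + O(1) bits for q.  The exponent j takes
    log log n + log d + O(1) bits.  The rounding is unbiased, so the errors are
    uncorrelated with everything computed elsewhere.  As the inputs are nonnegative,
    the sketches of disjoint subtrees are nonnegatively correlated, and by induction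
    towards the root the second moment of the sum received at height h exceeds that
    of the exact sketch by a factor (1 + 4^-s)^h at most, where s is the precision;
    2^s of order d/eps makes the final error O(eps). *)

(** * Breadth-first trees and convergecast *)

Section Tree.
Variables (m : nat) (G : rel 'I_m).

Definition walk (k : nat) (u v : 'I_m) : Prop :=
  exists p : seq 'I_m, [/\ size p = k, path G u p & last u p = v].

Lemma dist_le_walk u v k : walk k u v -> dist G u v <= k.
Proof.
move=> [p [sp pp lp]].
have wlogkm : k < m -> dist G u v <= k.
  move=> km; rewrite /dist leqNgt; apply/negP => /(before_find 0).
  rewrite nth_iota // => /negbT/existsP; apply.
  have sp' : size p == k by apply/eqP.
  by exists (Tuple sp'); rewrite /= pp lp eqxx.
(* For [k >= m] the bound is free: [find] never exceeds the length [m] of the range it searches. *)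
have [/wlogkm //|mk] := ltnP k m.
by apply: leq_trans mk; rewrite /dist -[X in _ <= X](size_iota 0) find_size.
Qed.

(** A connecting path can be made duplicate-free, hence has fewer than [m] edges, so the bounded
    search in [dist] succeeds. *)
Lemma walk_dist u v : connect G u v -> walk (dist G u v) u v.
Proof.
case/connectP => p pp ->.
have [q qq uq sq] := shortenP pp.
have sqm : size q < m.
  by have := max_card (mem (u :: q)); rewrite (card_uniqP uq) card_ord.
have hasP : has (fun k => [exists p : k.-tuple 'I_m,
    path G u p && (last u p == last u q)]) (iota 0 m).
  apply/hasP; exists (size q); first by rewrite mem_iota.
  by apply/existsP; exists (in_tuple q); rewrite /= qq eqxx.
have := nth_find 0 hasP; rewrite nth_iota; last by rewrite has_find size_iota in hasP.
rewrite add0n => /existsP [t /andP[pt /eqP lt]].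
by exists t; split => //; rewrite size_tuple.
Qed.

Hypotheses (Gs : symmetric G) (Gc : connected_graph G).
Variable root : 'I_m.

Notation lev := (dist G root).

(** The last vertex but one of a shortest walk from the root is a parent; appending an edge to a
    shortest walk to it gives the other inequality between the levels. *)
Lemma bfs_parent v : v != root ->
  exists p, G v p && (lev v == (lev p).+1).
Proof.
move=> vr; have [p] := walk_dist (Gc root v).
case/lastP: p => [[_ _ /= e]|p x [sp]]; first by rewrite e eqxx in vr.
rewrite rcons_path last_rcons => /andP[pp Gx] xv.
exists (last root p); rewrite Gs -xv Gx /=.
have sp' : lev v = (size p).+1 by rewrite -sp size_rcons.
have le1 : lev (last root p) <= size p by apply: dist_le_walk; exists p.
have [q [sq pq lq]] := walk_dist (Gc root (last root p)).
have : lev v <= (lev (last root p)).+1.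
  apply: dist_le_walk; exists (rcons q x).
  by rewrite size_rcons sq rcons_path pq lq last_rcons.
rewrite xv; lia.
Qed.

Lemma dist_le_diameter v : lev v <= diameter G.
Proof.
exact: leq_trans (leq_bigmax (F := dist G root) v) (leq_bigmax (F := ecc G) root).
Qed.

Definition parent (v : 'I_m) : 'I_m :=
  odflt v [pick p | G v p && (lev v == (lev p).+1)].

Lemma parentP v : v != root -> G v (parent v) /\ lev v = (lev (parent v)).+1.
Proof.
move=> /bfs_parent [p hp]; rewrite /parent; case: pickP => [q|/(_ p)].
  by case/andP=> ? /eqP.
by rewrite hp.
Qed.

(** The root has level 0, so [parent] sends it to itself by default; the first conjunct removes this
    loop. *)
Definition child (c v : 'I_m) : bool := (c != root) && (parent c == v).

Lemma child_lev c v : child c v -> lev c = (lev v).+1.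
Proof. by case/andP=> /parentP[_ +] /eqP <-. Qed.

Lemma dist_refl : lev root = 0.
Proof. by apply/eqP; rewrite -leqn0; apply: dist_le_walk; exists [::]. Qed.

End Tree.

Local Open Scope ring_scope.

(** * Binary codes of fixed length *)

Section Code.
Variables (T : finType) (b : nat).
Hypothesis Tb : (#|T| <= 2 ^ b)%N.

Let le_card : (#|T| <= #|{: b.-tuple bool}|)%N.
Proof. by rewrite card_tuple card_bool. Qed.

Definition encode (t : T) : b.-tuple bool :=
  enum_val (widen_ord le_card (enum_rank t)).

Definition decode (s : seq bool) : option T :=
  [pick t | tval (encode t) == s].

Lemma encodeK t : decode (encode t) = Some t.
Proof.
rewrite /decode; case: pickP => [u /eqP/val_inj|/(_ t)]; last by rewrite eqxx.
by move/enum_val_inj/(congr1 (@nat_of_ord _)) => /= /ord_inj/enum_rank_inj ->.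
Qed.

End Code.

(** * Summation towards the root as a protocol *)

Section Convergecast.
Variables (m : nat) (G : rel 'I_m) (root : 'I_m).
Hypotheses (Gs : symmetric G) (Gc : connected_graph G).
Variables (input output : Type) (T : finType) (b : nat) (L : nat) (V : zmodType).
Hypothesis Tb : (#|T| <= 2 ^ b)%N.
Hypothesis b_gt0 : (0 < b)%N.
(* A vertex only needs the sum of the values of the messages of its children, so
   that the order in which they arrive is irrelevant. *)
Variable value : T -> V.
Variable local : 'I_m -> input -> L.-tuple bool -> V -> T.
Variable final : input -> L.-tuple bool -> V -> output.

Notation lev := (dist G root).
Notation par := (parent G root).

(** Decreasing levels: each vertex transmits once, after all its children. The order depends on the
    graph only, as the public slots require. *)
Definition senders : seq 'I_m :=
  sort (fun u v => lev v <= lev u)%N [seq v <- enum 'I_m | v != root].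

Definition total (r : seq (seq bool)) : V :=
  \sum_(s <- r) if decode Tb s is Some t then value t else 0.

Definition cast_msg (k : nat) (x : input) (w : L.-tuple bool) (r : seq (seq bool)) :
    seq bool :=
  encode Tb (local (nth root senders k) x w (total r)).

Lemma mem_senders v : (v \in senders) = (v != root).
Proof. by rewrite mem_sort mem_filter mem_enum andbT. Qed.

Lemma uniq_senders : uniq senders.
Proof. by rewrite sort_uniq filter_uniq // enum_uniq. Qed.

Lemma cast_edge : all (fun a => G a.1 a.2) [seq (v, par v) | v <- senders].
Proof.
apply/allP => _ /mapP[v + ->] /=; rewrite mem_senders => vr.
by have [] := parentP Gs Gc vr.
Qed.

Lemma cast_nonempty k x w r : cast_msg k x w r != [::].
Proof. by rewrite -size_eq0 size_tuple -lt0n. Qed.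

Definition convergecast : protocol G input output :=
  @Protocol m G input output L [seq (v, par v) | v <- senders] cast_msg
    (fun x w r => final x w (total r)) cast_edge cast_nonempty.

(** [M] is any solution of the local recursion along the tree; the run of the protocol is shown to
    send exactly these messages. *)
Variables (x : 'I_m -> input) (w : L.-tuple bool) (M : 'I_m -> T).
Hypothesis M_local : forall v, v != root ->
  M v = local v (x v) w (\sum_(c | child G root c v) value (M c)).

Let entry v : ('I_m * 'I_m) * seq bool := ((v, par v), encode Tb (M v) : seq bool).

(** Here [s] is the list of vertices that have already sent: a prefix of [senders] during the run,
    all of [senders] at the output. *)
Lemma total_received (s : seq 'I_m) v : uniq s ->
  (forall c, c \in s -> c != root) ->
  (forall c, child G root c v -> c \in s) ->
  total (received v (map entry s)) = \sum_(c | child G root c v) value (M c).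
Proof.
move=> us sr cs; rewrite /received /total big_map big_filter big_map /=.
under eq_bigr do rewrite encodeK.
rewrite -big_filter -[RHS]big_filter; apply: perm_big; apply: uniq_perm.
- exact: filter_uniq.
- exact/filter_uniq/index_enum_uniq.
move=> c; rewrite !mem_filter mem_index_enum andbT /=; apply/andP/idP => [[/eqP pc cin]|cv].
  by rewrite /child (sr _ cin) pc eqxx.
by split; [case/andP: cv => _ | apply: cs].
Qed.

Lemma run_convergecast : run (P := convergecast) x w = map entry senders.
Proof.
have lev_trans : transitive (fun u v => lev v <= lev u)%N.
  by move=> u v t h1 h2; apply: leq_trans h1.
have srt : sorted (fun u v => lev v <= lev u)%N senders.
  by apply: sort_sorted => u v; apply: leq_total.
suff H s1 s2 : senders = s1 ++ s2 ->
    foldl (step (P := convergecast) x w) (map entry s1) [seq (v, par v) | v <- s2] =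
    map entry senders.
  exact: (H [::] senders).
elim: s2 s1 => [|v s2 IH] s1 es /=; first by rewrite es cats0.
have vs : v \in senders by rewrite es mem_cat inE eqxx orbT.
rewrite -(IH (rcons s1 v)); last by rewrite cat_rcons.
congr foldl; rewrite /step map_rcons; congr rcons; rewrite /entry; congr pair.
rewrite /= /cast_msg size_map es nth_cat ltnn subnn /=.
congr (tval _); congr encode; rewrite M_local -?mem_senders //; congr local.
apply: total_received.
- by have := uniq_senders; rewrite es cat_uniq => /andP[].
- by move=> c cs; rewrite -mem_senders es mem_cat cs.
(* A child lies one level deeper than [v], so the sorting by level places it before [v], that is in
   [s1]. *)
move=> c cv; have : c \in senders by rewrite mem_senders; case/andP: cv.
rewrite es mem_cat => /orP[//|cvs].
have := srt; rewrite es (sorted_pairwise lev_trans) pairwise_cat => /and3P[_ _].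
move: cvs; rewrite inE => /orP[/eqP e|cs2] /=.
  by have := child_lev Gs Gc cv; rewrite e; lia.
by case/andP => /allP/(_ _ cs2) + _; rewrite (child_lev Gs Gc cv); lia.
Qed.

Lemma output_convergecast :
  output_at (P := convergecast) x w root =
  final (x root) w (\sum_(c | child G root c root) value (M c)).
Proof.
rewrite /output_at run_convergecast /=; congr final; apply: total_received.
- exact: uniq_senders.
- by move=> c; rewrite mem_senders.
by move=> c /andP[cr _]; rewrite mem_senders.
Qed.

(** A slot on the edge between [u] and [v] has one of them as its sender, and every vertex sends at
    most once. *)
Lemma max_comm_convergecast : (max_comm (P := convergecast) x w <= 2 * b)%N.
Proof.
apply/bigmax_leqP => -[u v] _ /=; rewrite /edge_bits run_convergecast big_map /=.
under eq_bigr do rewrite size_tuple.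
rewrite big_const_seq iter_addn_0.
have one t : (count (pred1 t) senders <= 1)%N.
  by rewrite count_uniq_mem ?uniq_senders // leq_b1.
rewrite mulnC leq_mul2r; apply/orP; right.
apply: leq_trans (leq_add (one u) (one v)).
rewrite -count_predUI.
apply: leq_trans (leq_addr _ _); apply: sub_count => t /=.
by case/orP => /eqP[-> _]; rewrite eqxx ?orbT.
Qed.

End Convergecast.

(** * Fair coins *)

Section Coins.
Variables (R : realType) (I : finType).

Notation Omega := (#|I|.-tuple bool).
Implicit Types (w : Omega) (i j : I) (f g : Omega -> R).

(** Coins are named by a finite type rather than by position, so that sign coins and rounding coins
    are told apart by constructors. *)
Definition coin w i : bool := tnth w (enum_rank i).
Definition sgn w i : R := (-1) ^+ coin w i.
Definition flip i w : Omega :=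
  [tuple if j == enum_rank i then ~~ tnth w j else tnth w j | j < #|I|].

(** A pointwise form of independence: [f] does not look at coin [i]. It is checked by inspecting
    which coins occur in [f]. *)
Definition indep (T : Type) i (f : Omega -> T) := forall w, f (flip i w) = f w.

Lemma coin_flip i j w : coin (flip i w) j = (if j == i then ~~ coin w j else coin w j).
Proof. by rewrite /coin tnth_mktuple (inj_eq enum_rank_inj). Qed.

Lemma flipK i : involutive (flip i).
Proof.
move=> w; apply: eq_from_tnth => j.
by rewrite !tnth_mktuple; case: eqP => // _; rewrite negbK.
Qed.

Lemma sgn_flip i w : sgn (flip i w) i = - sgn w i.
Proof. by rewrite /sgn coin_flip eqxx; case: coin; rewrite !(expr0, expr1, opprK). Qed.

Lemma sgn_sq w i : sgn w i * sgn w i = 1.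
Proof. by rewrite -expr2 /sgn sqrr_sign. Qed.

Lemma coin_indep i j : j != i -> indep i (coin^~ j).
Proof. by move=> /negbTE ji w; rewrite coin_flip ji. Qed.

Lemma sgn_indep i j : j != i -> indep i (sgn^~ j).
Proof. by move=> ji w; rewrite /sgn coin_indep. Qed.

Definition Ex f : R := (\sum_w f w) / 2 ^+ #|I|.

Lemma eq_Ex f g : f =1 g -> Ex f = Ex g.
Proof. by move=> fg; rewrite /Ex (eq_bigr _ (fun w _ => fg w)). Qed.

Lemma ExD f g : Ex (fun w => f w + g w) = Ex f + Ex g.
Proof. by rewrite /Ex big_split mulrDl. Qed.

Lemma ExZ a f : Ex (fun w => a * f w) = a * Ex f.
Proof. by rewrite /Ex -mulr_sumr mulrA. Qed.

Lemma ExN f : Ex (fun w => - f w) = - Ex f.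
Proof. by rewrite /Ex sumrN mulNr. Qed.

Lemma Ex_sum (J : Type) (r : seq J) (P : pred J) (F : J -> Omega -> R) :
  Ex (fun w => \sum_(j <- r | P j) F j w) = \sum_(j <- r | P j) Ex (F j).
Proof. by rewrite /Ex exchange_big mulr_suml. Qed.

Lemma Ex_cst a : Ex (fun=> a) = a.
Proof.
rewrite /Ex sumr_const card_tuple card_bool -[a *+ _]mulr_natr natrX mulfK //.
by rewrite expf_neq0 // pnatr_eq0.
Qed.

Lemma le_Ex f g : (forall w, f w <= g w) -> Ex f <= Ex g.
Proof. by move=> fg; rewrite ler_wpM2r ?invr_ge0 ?exprn_ge0 // ler_sum. Qed.

Lemma Ex_ge0 f : (forall w, 0 <= f w) -> 0 <= Ex f.
Proof. by move=> f0; rewrite divr_ge0 ?exprn_ge0 ?sumr_ge0. Qed.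

Lemma Ex_flip i f : Ex (f \o flip i) = Ex f.
Proof. by rewrite /Ex [in RHS](reindex_inj (inv_inj (flipK i))). Qed.

(** Flipping coin [i] preserves the uniform measure and negates the integrand. All orthogonality
    relations below reduce to this. *)
Lemma Ex_sgn0 i f : indep i f -> Ex (fun w => sgn w i * f w) = 0.
Proof.
move=> fi; have := Ex_flip i (fun w => sgn w i * f w).
rewrite (eq_Ex (g := fun w => - (sgn w i * f w))) ?ExN; first lra.
by move=> w /=; rewrite sgn_flip fi mulNr.
Qed.

Lemma prob_markov f (B c : R) : (forall w, 0 <= f w) -> Ex f <= B -> 0 < c ->
  uniform_prob R (fun w => ~~ (f w <= c * B)) <= c^-1.
Proof.
move=> f0 fB c0; have B0 : 0 <= B by apply: le_trans fB; apply: Ex_ge0.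
have pE : uniform_prob R (fun w => ~~ (f w <= c * B)) =
    Ex (fun w => (~~ (f w <= c * B))%:R).
  rewrite /uniform_prob /Ex -sum1dep_card natr_sum big_mkcond /=.
  by congr (_ / _); apply: eq_bigr => w _; case: ifP.
(* Division by [B] fails when [B = 0]; then [f] has mean 0, and as every outcome has positive
   weight, [f] vanishes identically and the event is empty. *)
rewrite pE; move: B0; rewrite le_eqVlt => /orP[/eqP B0|B0].
  rewrite (eq_Ex (g := fun=> 0)) ?Ex_cst ?invr_ge0 ?ltW // => w.
  suff -> : f w = 0 by rewrite -B0 mulr0 lexx.
  apply/eqP; rewrite eq_le f0 andbT leNgt; apply/negP => fw.
  have : 0 < Ex f.
    rewrite divr_gt0 ?exprn_gt0 // (bigD1 w) //=.
    by rewrite ltr_wpDr // sumr_ge0.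
  lra.
have cB0 : 0 < c * B by rewrite mulr_gt0.
have -> : c^-1 = (c * B)^-1 * B by field; rewrite !gt_eqF.
apply: le_trans (ler_wpM2l _ fB); last by rewrite invr_ge0 ltW.
rewrite -ExZ; apply: le_Ex => w; case: (leP (f w) (c * B)) => /= h.
  by rewrite mulr_ge0 // invr_ge0 ltW.
by rewrite mulrC ler_pdivlMr // mul1r ltW.
Qed.

End Coins.

Lemma uniform_probC (R : realType) L (E : pred (L.-tuple bool)) :
  uniform_prob R E = 1 - uniform_prob R (predC E).
Proof.
have : (#|[set w | E w]| + #|[set w | ~~ E w]|)%N = (2 ^ L)%N.
  rewrite -card_bool -card_tuple -(cardsC [set w | E w]); congr addn.
  by apply: eq_card => w; rewrite !inE.
move=> /(congr1 (fun k : nat => k%:R : R)); rewrite natrD natrX => e.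
have p : 0 < 2 ^+ L :> R by rewrite exprn_gt0.
rewrite /uniform_prob /=; apply/eqP.
by rewrite eq_sym subr_eq -mulrDl [X in X / _]e divff ?lt0r_neq0.
Qed.

Lemma uniform_prob_sub (R : realType) L (E F : pred (L.-tuple bool)) :
  (forall w, E w -> F w) -> uniform_prob R E <= uniform_prob R F.
Proof.
move=> EF; rewrite ler_wpM2r ?invr_ge0 ?exprn_ge0 // ler_nat subset_leq_card //.
by apply/subsetP => w; rewrite !inE; apply: EF.
Qed.

Lemma uniform_probU (R : realType) L (E F : pred (L.-tuple bool)) :
  uniform_prob R (predU E F) <= uniform_prob R E + uniform_prob R F.
Proof.
rewrite -mulrDl ler_wpM2r ?invr_ge0 ?exprn_ge0 // -natrD ler_nat.
apply: leq_trans (leq_card_setU _ _); rewrite subset_leq_card //.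
by apply/subsetP => w; rewrite !inE.
Qed.

(** * Unbiased rounding *)

Lemma Posz_pow2 j : (2 ^ j)%N = 2 ^+ j :> int.
Proof. by rewrite -[LHS]natz natrX. Qed.

(* Randomized rounding by one binary digit at a time: an odd number is replaced by
   one of its two neighbours before halving.  Only fair coins are needed, and the
   error of each step is a random sign times a function of the previous coins. *)
Fixpoint halve (x : nat) (c : nat -> bool) (j : nat) : nat :=
  if j is i.+1 then let y := halve x c i in (y./2 + (odd y && c i))%N else x.

(** The number of binary digits dropped. The truncated subtraction gives 0 when [x] has at most
    [s + 1] digits, and such [x] is kept exactly. *)
Definition expo (s x : nat) : nat := (trunc_log 2 x - s)%N.

Definition round_nat (s x : nat) (c : nat -> bool) : nat :=
  (halve x c (expo s x) * 2 ^ expo s x)%N.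

Definition round_int (s : nat) (z : int) (c : nat -> bool) : int :=
  sgz z * (round_nat s `|z| c)%:Z.

Lemma halve_step x c i : (halve x c i.+1).*2%:Z
  = (halve x c i)%:Z - (odd (halve x c i))%:Z * (-1) ^+ c i.
Proof.
rewrite /=; set y := halve x c i; have e := odd_double_half y.
rewrite -[in y%:Z - _]e; case: (odd y); case: (c i) => /=;
  rewrite ?expr0 ?expr1; lia.
Qed.

(** The step errors telescope, the one at digit [i] having weight [2 ^ i]. *)
Lemma halve_error x c j : (halve x c j)%:Z * 2 ^+ j - x%:Z =
  - \sum_(i < j) (odd (halve x c i))%:Z * (-1) ^+ c i * 2 ^+ i.
Proof.
elim: j => [|j IH]; first by rewrite big_ord0 expr0 mulr1 subrr oppr0.
rewrite big_ord_recr /= opprD -IH exprS mulrA.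
have -> : (halve x c j.+1)%:Z * 2 = (halve x c j.+1).*2%:Z by lia.
by rewrite halve_step; ring.
Qed.

Lemma sum_pow2 j : \sum_(i < j) 2 ^+ i = 2 ^+ j - 1 :> int.
Proof.
by elim: j => [|j IH]; rewrite ?big_ord0 // big_ord_recr /= IH exprS; ring.
Qed.

Lemma halve_error_lt x c j : `|(halve x c j)%:Z * 2 ^+ j - x%:Z| < 2 ^+ j.
Proof.
rewrite halve_error normrN; apply: le_lt_trans (ler_norm_sum _ _ _) _.
apply: (@le_lt_trans _ _ (\sum_(i < j) 2 ^+ i)); last first.
  by rewrite sum_pow2 ltrBlDr ltrDl.
apply: ler_sum => i _; rewrite !normrM normrX normrN normr1 expr1n mulr1.
rewrite [`|2 ^+ i|]ger0_norm ?exprn_ge0 // ler_piMl ?exprn_ge0 //.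
by case: odd.
Qed.

Lemma expo_le s x : (0 < expo s x)%N -> (2 ^ (s + expo s x) <= x)%N.
Proof.
move=> j0; have x0 : (0 < x)%N.
  by case: x j0 => //; rewrite /expo trunc_log0.
apply: leq_trans (trunc_logP (p := 2) isT x0).
by rewrite leq_exp2l //; move: j0; rewrite /expo; lia.
Qed.

Lemma round_nat_error s x c :
  2 ^+ s * `|(round_nat s x c)%:Z - x%:Z| <= x%:Z.
Proof.
rewrite /round_nat; have [j0|j0] := posnP (expo s x).
  by rewrite j0 /= expn0 muln1 subrr normr0 mulr0.
have h := halve_error_lt x c (expo s x).
have e : (halve x c (expo s x) * 2 ^ expo s x)%N%:Z
   = (halve x c (expo s x))%:Z * 2 ^+ expo s x by rewrite PoszM Posz_pow2.
rewrite e; apply: (@le_trans _ _ (2 ^+ s * 2 ^+ expo s x)).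
  by rewrite ler_wpM2l ?exprn_ge0 // ltW.
by have := expo_le j0; rewrite -exprD -Posz_pow2.
Qed.

(** Since [x < 2 ^ (s + 1 + j)] and the error is below [2 ^ j], a carry can bring the mantissa up to
    [2 ^ (s + 1)] itself; this costs one more bit. *)
Lemma mantissa_lt s x c : (halve x c (expo s x) < 2 ^ s.+2)%N.
Proof.
have h := halve_error_lt x c (expo s x); move: h.
set y := halve _ _ _; set j := expo s x => h.
have xl : (x < 2 ^ (s.+1 + j))%N.
  apply: leq_trans (trunc_log_ltn x (p := 2) isT) _.
  by rewrite leq_exp2l // /j /expo; lia.
have h2 : (y * 2 ^ j < 2 ^ j + x)%N.
  by move: h; rewrite -Posz_pow2; lia.
have : (y * 2 ^ j < 2 ^ s.+2 * 2 ^ j)%N.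
  rewrite !expnS; move: xl; rewrite expnD expnS => xl.
  have : (0 < 2 ^ s)%N by rewrite expn_gt0.
  move: (2 ^ s)%N (2 ^ j)%N xl h2 => a b; nia.
by rewrite ltn_mul2r => /andP[].
Qed.

Lemma round_int_error s z c : 2 ^+ s * `|round_int s z c - z| <= `|z|.
Proof.
have -> : round_int s z c - z = sgz z * ((round_nat s `|z| c)%:Z - `|z|%N%:Z).
  by rewrite mulrBr -intEsg.
rewrite normrM; have := round_nat_error s `|z| c; rewrite abszE.
case: (sgzP z) => [->|_|_]; rewrite ?normr0 ?normr1 ?normrN1
  ?mul0r ?mulr0 ?mul1r ?normrN ?normr1 ?mul1r //.
Qed.

Lemma round_int_le s z c : `|round_int s z c| <= 2 * `|z|.
Proof.
have h := round_int_error s z c.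
have : `|round_int s z c - z| <= `|z|.
  apply: le_trans h; rewrite ler_peMl //; exact: exprn_ege1.
lia.
Qed.

Section Unbiased.
Variables (R : realType) (I : finType).
Notation Omega := (#|I|.-tuple bool).
Variables (s : nat) (z : Omega -> int) (B : nat) (k : nat -> I).
Hypothesis k_inj : {in [pred i | i < B]%N &, injective k}.
Hypothesis zB : forall w, (expo s `|z w| <= B)%N.
Hypothesis z_indep : forall i, (i < B)%N -> indep (k i) z.

Lemma halve_eq x c c' j : (forall i, (i < j)%N -> c i = c' i) -> halve x c j = halve x c' j.
Proof.
elim: j => //= j IH h; rewrite IH ?h // => i ij; exact/h/ltnW.
Qed.

(** The error is a sum of signs, each multiplied by a function of [z] and of earlier rounding coins;
    every term is orthogonal to [f]. *)
Lemma round_int_unbiased (f : Omega -> R) :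
  (forall i, (i < B)%N -> indep (k i) f) ->
  Ex (fun w => (round_int s (z w) (coin w \o k) - z w)%:~R * f w) = 0.
Proof.
move=> f_indep.
(* The number of rounding steps depends on the outcome; the coefficients are extended by 0 up to the
   fixed bound [B] so that sum and expectation commute. *)
pose h (i : nat) w : int := if (i < expo s `|z w|)%N then
   sgz (z w) * ((odd (halve `|z w| (coin w \o k) i))%:Z * 2 ^+ i) else 0.
rewrite (@eq_Ex _ _ _ (fun w =>
    \sum_(i < B) sgn R w (k i) * (- (h i w)%:~R * f w))); last first.
  move=> w; under eq_bigr do rewrite mulrA.
  rewrite -mulr_suml; congr (_ * _).
  rewrite /round_int /round_nat PoszM Posz_pow2 [X in _ - X]intEsg -mulrBr halve_error.
  rewrite mulrN mulr_sumr -sumrN.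
  rewrite (big_ord_widen B (fun i => - (sgz (z w) *
    ((odd (halve `|z w| (coin w \o k) i))%:Z * (-1) ^+ (coin w \o k) i * 2 ^+ i)))) ?zB //.
  rewrite big_mkcond /=.
  rewrite rmorph_sum /=; apply: eq_bigr => i _; rewrite /h /sgn /=.
  case: ifP => _; last by rewrite oppr0 mulr0.
  by rewrite rmorphN !rmorphM !rmorphXn rmorphN1 /=; ring.
rewrite Ex_sum big1 // => i _; apply: Ex_sgn0 => w.
have iB := ltn_ord i; rewrite f_indep //; congr (- _%:~R * _).
rewrite /h z_indep //; congr (if _ then _ * (_%:Z * _) else _); congr (nat_of_bool (odd _)).
apply: halve_eq => i' i'i /=; apply: coin_indep.
apply/eqP => /k_inj; rewrite !inE => /(_ (ltn_trans i'i iB) iB) e.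
by rewrite e ltnn in i'i.
Qed.

End Unbiased.

(** * Moments of the rounded sums *)

Definition dot (R : realType) (n : nat) (x y : 'I_n -> R) : R := \sum_q x q * y q.

Lemma dotC (R : realType) n (x y : 'I_n -> R) : dot x y = dot y x.
Proof. by apply: eq_bigr => q _; rewrite mulrC. Qed.

Lemma dot_addsum (R : realType) n (J : finType) (P : pred J) (a x : 'I_n -> R) f :
  dot (fun q => a q + \sum_(c | P c) f c q) x = dot a x + \sum_(c | P c) dot (f c) x.
Proof.
rewrite /dot exchange_big -big_split /=; apply: eq_bigr => q _.
by rewrite mulrDl mulr_suml.
Qed.

Lemma Ex_mul_addsum (R : realType) (I : finType) (J : finType) (P Q : pred J)
    (a b : #|I|.-tuple bool -> R) (f g : J -> #|I|.-tuple bool -> R) :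
  Ex (fun w => (a w + \sum_(c | P c) f c w) * (b w + \sum_(c | Q c) g c w)) =
  Ex (fun w => a w * b w) + \sum_(c | Q c) Ex (fun w => a w * g c w) +
  \sum_(c | P c) (Ex (fun w => f c w * b w) +
    \sum_(c' | Q c') Ex (fun w => f c w * g c' w)).
Proof.
under [X in _ + X]eq_bigr do rewrite -Ex_sum -ExD.
rewrite -!Ex_sum -!ExD; apply: eq_Ex => w.
rewrite mulrDl mulrDr mulr_sumr mulr_suml; congr (_ + _).
by apply: eq_bigr => c _; rewrite mulrDr mulr_sumr.
Qed.

Section TreeFold.
Variables (m : nat) (G : rel 'I_m) (root : 'I_m).
Hypotheses (Gs : symmetric G) (Gc : connected_graph G).
Variables (V : zmodType) (own : 'I_m -> V) (phi : 'I_m -> V -> V) (D : nat).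
Hypothesis lev_le : forall v, (dist G root v <= D)%N.

(* A vertex on level [l] needs fuel [D - l]. *)
Fixpoint fold_fuel (h : nat) (v : 'I_m) : V :=
  own v + \sum_(c | child G root c v) (if h is i.+1 then phi c (fold_fuel i c) else 0).

Definition tree_fold v := fold_fuel (D - dist G root v) v.

(** Fuel runs out only at level [D] or deeper, where no children exist. *)
Lemma tree_foldE v :
  tree_fold v = own v + \sum_(c | child G root c v) phi c (tree_fold c).
Proof.
rewrite [LHS]/tree_fold; case h: (D - dist G root v)%N => [|i] /=; congr (_ + _).
  by rewrite !big_pred0 // => c; apply/negP => /(child_lev Gs Gc) e;
     have := lev_le c; lia.
apply: eq_bigr => c cv; congr (phi c _); rewrite /tree_fold; congr (fold_fuel _ _).
by have := child_lev Gs Gc cv; lia.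
Qed.

End TreeFold.

(** * Second moments of one sketch entry along the tree *)

Section Tree.
Variables (m : nat) (G : rel 'I_m) (root : 'I_m).
Hypotheses (Gs : symmetric G) (Gc : connected_graph G).
Notation lev := (dist G root).
Notation child := (child G root).

(** Summing the recursion over all vertices counts every non-root vertex once as a child, so all
    terms [A c] but that of the root cancel. *)
Lemma subtree_sum_root (V : zmodType) (X A : 'I_m -> V) :
  (forall v, A v = X v + \sum_(c | child c v) A c) -> A root = \sum_v X v.
Proof.
move=> AE; have : \sum_v A v = \sum_v X v + \sum_(c | c != root) A c.
  rewrite (eq_bigr _ (fun v _ => AE v)) big_split /=; congr (_ + _).
  rewrite [RHS](partition_big (parent G root) xpredT) //=.
by rewrite (bigD1 root) //= => /addIr.
Qed.

(** One entry of the sketch is followed: [sc] names the sign coins of its row, [bc c] the rounding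
    coins of vertex [c], [A v] is the exact column sum over the subtree of [v], and [z v] the
    integer held at [v] before rounding. *)
Variables (R : realType) (I : finType) (n B s D : nat).
Variables (sc : 'I_n -> I) (bc : 'I_m -> nat -> I).
Hypothesis sc_inj : injective sc.
Hypothesis bc_inj : forall c c' i i', (i < B)%N -> (i' < B)%N ->
  bc c i = bc c' i' -> c = c' /\ i = i'.
Hypothesis bc_sc : forall c i q, (i < B)%N -> bc c i != sc q.
Hypothesis lev_le : forall v, (lev v <= D)%N.

Notation Omega := (#|I|.-tuple bool).
Variables (X : 'I_m -> 'I_n -> nat) (A : 'I_m -> 'I_n -> R).
Hypothesis A_rec : forall v q, A v q = (X v q)%:R + \sum_(c | child c v) A c q.
Variable z : 'I_m -> Omega -> int.
Definition rounded c w := round_int s (z c w) (coin w \o bc c).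
Hypothesis z_rec : forall v w, z v w =
  \sum_q (-1) ^+ coin w (sc q) * (X v q)%:Z + \sum_(c | child c v) rounded c w.
Hypothesis z_expo : forall v w, (expo s `|z v w| <= B)%N.

Definition sketch (x : 'I_n -> R) (w : Omega) : R := \sum_q sgn R w (sc q) * x q.

Definition fresh (T : Type) c (f : Omega -> T) :=
  forall i, (i < B)%N -> indep (bc c i) f.

Lemma sketch_fresh c x : fresh c (sketch x).
Proof.
move=> i iB w; apply: eq_bigr => q _; rewrite sgn_indep //.
by rewrite eq_sym bc_sc.
Qed.

Lemma rounded_fresh c c' : c != c' -> fresh c (z c') -> fresh c (rounded c').
Proof.
move=> cc' zc i iB w; rewrite /rounded zc //.
rewrite /round_int /round_nat; congr (_ * _%:Z); congr (_ * _)%N.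
apply: halve_eq => j jB /=; apply: coin_indep.
apply/eqP => /bc_inj []; [exact: leq_trans jB (z_expo _ _)|by []|].
by move=> e; rewrite e eqxx in cc'.
Qed.

(** Only proper descendants of [v] have rounded anything that enters [z v]; they lie strictly below
    level [lev v], so [c] is not among them. *)
Lemma z_fresh c v : (lev c <= lev v)%N -> fresh c (z v).
Proof.
move: {2}(D - lev v)%N (leqnn (D - lev v)) => h.
elim: h v => [|h IH] v hv cv i iB w; rewrite !z_rec; congr (_ + _).
- by apply: eq_bigr => q _; rewrite coin_indep // eq_sym bc_sc.
- by rewrite !big_pred0 // => c'; apply/negP => /(child_lev Gs Gc) e;
     have := lev_le c'; lia.
- by apply: eq_bigr => q _; rewrite coin_indep // eq_sym bc_sc.
apply: eq_bigr => c' /(child_lev Gs Gc) e; apply: rounded_fresh => //.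
  by apply/eqP => ec; move: cv; rewrite ec e ltnn.
by apply: IH; lia.
Qed.

Definition err c w : R := (rounded c w - z c w)%:~R.

Lemma err_orth c f : fresh c f -> Ex (fun w => err c w * f w) = 0.
Proof.
move=> fc; apply: (round_int_unbiased (B := B)) => //.
- by move=> i i' iB i'B /bc_inj [].
- by move=> i iB; apply: z_fresh.
Qed.

Lemma roundedE c w : (rounded c w)%:~R = (z c w)%:~R + err c w.
Proof. by rewrite /err rmorphB /= addrCA subrr addr0. Qed.

Lemma fresh_intr c (f : Omega -> int) : fresh c f -> fresh c (fun w => (f w)%:~R : R).
Proof. by move=> fc i iB w; rewrite fc. Qed.

Lemma err_fresh c c' : c != c' -> fresh c (z c') -> fresh c (err c').
Proof.
by move=> cc' zc i iB w; rewrite /err (rounded_fresh cc' zc) // zc.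
Qed.

Lemma Ex_sketch x y : Ex (fun w => sketch x w * sketch y w) = dot x y.
Proof.
under eq_Ex do rewrite /sketch mulr_suml.
rewrite Ex_sum; apply: eq_bigr => q _.
under eq_Ex do rewrite mulr_sumr (bigD1 q) //=.
rewrite ExD [X in _ + X](_ : _ = 0) ?addr0.
  under eq_Ex do rewrite mulrACA sgn_sq mul1r.
  exact: Ex_cst.
rewrite Ex_sum big1 // => q' qq'.
under eq_Ex do rewrite -mulrA.
apply: Ex_sgn0 => w; rewrite sgn_indep //.
by rewrite (inj_eq sc_inj).
Qed.

Lemma zE v w : (z v w)%:~R =
  sketch (fun q => (X v q)%:R) w + \sum_(c | child c v) (rounded c w)%:~R.
Proof.
rewrite z_rec rmorphD /= !rmorph_sum; congr (_ + _).
by apply: eq_bigr => q _; rewrite rmorphM rmorphXn rmorphN1.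
Qed.

Lemma AE v x : dot (A v) x =
  dot (fun q => (X v q)%:R) x + \sum_(c | child c v) dot (A c) x.
Proof. by rewrite -dot_addsum; apply: eq_bigr => q _; rewrite A_rec. Qed.

Lemma A_ge0 v q : 0 <= A v q.
Proof.
move: {2}(D - lev v)%N (leqnn (D - lev v)) => h.
elim: h v => [|h IH] v hv; rewrite A_rec.
  rewrite big_pred0 ?addr0 // => c; apply/negP => /(child_lev Gs Gc) e.
  by have := lev_le c; lia.
rewrite addr_ge0 // sumr_ge0 // => c /(child_lev Gs Gc) e; apply: IH; lia.
Qed.

(** Here the nonnegativity of the inputs enters: the cross terms between subtrees may be multiplied
    by a factor at least 1 in the induction on second moments. *)
Lemma dot_A_ge0 v v' : 0 <= dot (A v) (A v').
Proof. by apply: sumr_ge0 => q _; rewrite mulr_ge0 ?A_ge0. Qed.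

(** The largest factor by which one rounding raises a second moment: the relative error is at most
    [2 ^ -s], and its square is [4 ^ -s]. *)
Definition growth : R := 1 + (4 ^+ s)^-1.

Lemma growth_ge1 : 1 <= growth.
Proof. by rewrite lerDl invr_ge0 exprn_ge0. Qed.

Lemma err_sq_le c : Ex (fun w => err c w * err c w) <=
  (4 ^+ s)^-1 * Ex (fun w => (z c w)%:~R * (z c w)%:~R).
Proof.
rewrite -ExZ; apply: le_Ex => w.
rewrite ler_pdivlMl ?exprn_gt0 //.
have := round_int_error s (z c w) (coin w \o bc c).
rewrite -(ler_int R) rmorphM rmorphXn /= !intr_norm -/(rounded c w) -/(err c w).
move=> h; have -> : (4 : R) = 2 ^+ 2 by rewrite expr2; ring.
rewrite -exprM mulnC exprM -!expr2 -[leRHS](real_normK (num_real _)).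
rewrite -[err c w ^+ 2](real_normK (num_real _)).
rewrite -exprMn ler_sqr ?nnegrE ?mulr_ge0 ?exprn_ge0 //.
Qed.

(* On a common level the rounding errors of distinct subtrees use disjoint coins, so
   the mixed moments are those of the exact sketches, and only the second moments
   grow. *)
Definition level_moments v := forall v', lev v = lev v' ->
  [/\ forall x, Ex (fun w => (z v w)%:~R * sketch x w) = dot (A v) x,
      v != v' -> Ex (fun w => (z v w)%:~R * (z v' w)%:~R) = dot (A v) (A v')
    & Ex (fun w => (z v w)%:~R * (z v w)%:~R)
        <= growth ^+ (D - lev v) * dot (A v) (A v)].

Lemma Ex_rounded_sketch c x : level_moments c ->
  Ex (fun w => (rounded c w)%:~R * sketch x w) = dot (A c) x.
Proof.
move=> /(_ c erefl) [mS _ _].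
under eq_Ex do rewrite roundedE mulrDl.
by rewrite ExD err_orth ?addr0 ?mS //; apply: sketch_fresh.
Qed.

Lemma Ex_rounded_pair c c' : level_moments c -> lev c = lev c' -> c != c' ->
  Ex (fun w => (rounded c w)%:~R * (rounded c' w)%:~R) = dot (A c) (A c').
Proof.
move=> mc cc' nc; have [_ /(_ nc) <- _] := mc _ cc'.
under eq_Ex do rewrite !roundedE mulrDr mulrDl [(_ + err c _) * err c' _]mulrC.
rewrite !ExD !err_orth ?addr0 //.
  move=> i iB w; rewrite (fresh_intr (z_fresh _)) ?cc' // err_fresh //.
    by rewrite eq_sym.
  by apply: z_fresh; rewrite cc'.
by apply: fresh_intr; apply: z_fresh; rewrite cc'.
Qed.

(** Pythagoras: the error at [c] is orthogonal to [z c], so the two second moments add up. *)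
Lemma Ex_rounded_sq c : level_moments c ->
  Ex (fun w => (rounded c w)%:~R * (rounded c w)%:~R)
    <= growth ^+ (D - lev c).+1 * dot (A c) (A c).
Proof.
move=> /(_ c erefl) [_ _ zz].
have zf : fresh c (fun w => (z c w)%:~R : R) by apply: fresh_intr; apply: z_fresh.
rewrite (@eq_Ex _ _ _ (fun w => ((z c w)%:~R * (z c w)%:~R +
   err c w * err c w) + (err c w * (z c w)%:~R + err c w * (z c w)%:~R))); last first.
  by move=> w; rewrite roundedE; ring.
rewrite !ExD !(err_orth zf) !addr0 exprS -mulrA.
apply: le_trans (ler_wpM2l (le_trans ler01 growth_ge1) zz).
by rewrite [leRHS]mulrDl mul1r lerD2l err_sq_le.
Qed.

Lemma moments_step v :
  (forall c, lev c = (lev v).+1 -> level_moments c) -> level_moments v.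
Proof.
move=> mc v' vv'; set Xr := fun v q => (X v q)%:R : R.
have mch c : child c v -> level_moments c by move=> /(child_lev Gs Gc) /mc.
have mch' c : child c v' -> level_moments c.
  by move=> /(child_lev Gs Gc) e; apply: mc; rewrite e vv'.
(* [zz] and [AA] are parallel expansions over the children, stated for any [u] on the level so as to
   serve both [u = v'] and [u = v]; they differ only in the child-child terms. *)
have zz u : lev v = lev u -> Ex (fun w => (z v w)%:~R * (z u w)%:~R) =
  dot (Xr v) (Xr u) + \sum_(c | child c u) dot (A c) (Xr v) +
  \sum_(c | child c v) (dot (A c) (Xr u) + \sum_(c' | child c' u)
    Ex (fun w => (rounded c w)%:~R * (rounded c' w)%:~R)).
  move=> vu; under eq_Ex do rewrite !zE.
  rewrite Ex_mul_addsum Ex_sketch; congr (_ + _ + _); apply: eq_bigr => c cu.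
    under eq_Ex do rewrite mulrC.
    rewrite Ex_rounded_sketch //; apply: mc.
    by rewrite (child_lev Gs Gc cu) vu.
  by rewrite Ex_rounded_sketch //; exact: mch.
have AA u : dot (A v) (A u) =
  dot (Xr v) (Xr u) + \sum_(c | child c u) dot (A c) (Xr v) +
  \sum_(c | child c v) (dot (A c) (Xr u) + \sum_(c' | child c' u) dot (A c) (A c')).
  rewrite AE dotC AE dotC; congr (_ + _ + _).
  by apply: eq_bigr => c cv; rewrite dotC AE dotC; under eq_bigr do rewrite dotC.
split.
- move=> x; under eq_Ex do rewrite zE mulrDl [X in _ + X]mulr_suml.
  rewrite ExD Ex_sketch Ex_sum AE; congr (_ + _).
  by apply: eq_bigr => c cv; rewrite Ex_rounded_sketch //; exact: mch.
- move=> nv; rewrite zz // AA; congr (_ + _); apply: eq_bigr => c cv.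
  congr (_ + _); apply: eq_bigr => c' cv'; apply: Ex_rounded_pair; first exact: mch.
    by rewrite (child_lev Gs Gc cv) (child_lev Gs Gc cv') vv'.
  (* A vertex has one parent, so the children of distinct vertices are distinct and no diagonal term
     occurs. *)
  apply: contraNneq nv => cc'; move: cv cv'; rewrite cc'.
  by case/andP=> _ /eqP <- /andP[_ /eqP <-].
(* All terms are nonnegative, so each exact one is at most [g] times itself; only the terms with
   [c = c'] need the growth, one power more than at level [lev c]. *)
rewrite zz // AA; set g := growth ^+ _.
have g1 : 1 <= g by apply: exprn_ege1 growth_ge1.
have XA u c : 0 <= dot (A c) (Xr u).
  by apply: sumr_ge0 => q _; rewrite mulr_ge0 ?A_ge0 /Xr.
have le_g y : 0 <= y -> y <= g * y by move=> y0; rewrite ler_peMl.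
rewrite !mulrDr; apply: lerD; [apply: lerD|].
- by apply: le_g; apply: sumr_ge0 => q _; rewrite mulr_ge0 /Xr.
- by apply: le_g; apply: sumr_ge0.
rewrite mulr_sumr; apply: ler_sum => c cv; rewrite mulrDr; apply: lerD; first exact: le_g.
rewrite mulr_sumr; apply: ler_sum => c' cv'.
have [<-|nc] := eqVneq c c'; last first.
  rewrite Ex_rounded_pair ?le_g ?dot_A_ge0 //; first exact: mch.
  by rewrite (child_lev Gs Gc cv) (child_lev Gs Gc cv').
apply: le_trans (Ex_rounded_sq (mch _ cv)) _.
by rewrite /g; have e := child_lev Gs Gc cv; have := lev_le c;
  rewrite e => hD; have -> : (D - (lev v).+1).+1 = (D - lev v)%N by lia.
Qed.

Lemma moments v : level_moments v.
Proof.
move: {2}(D - lev v)%N (leqnn (D - lev v)) => h.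
elim: h v => [|h IH] v hv; apply: moments_step => c e; have := lev_le c.
  lia.
by move=> cD; apply: IH; lia.
Qed.

(** After expanding the square, the mixed moment equals the squared norm exactly, so the error is
    the excess of the second moment of [z root]. *)
Lemma root_error :
  Ex (fun w => ((z root w)%:~R - sketch (fun q => \sum_v (X v q)%:R) w) ^+ 2) <=
  (growth ^+ D - 1) * dot (fun q => \sum_v (X v q)%:R : R) (fun q => \sum_v (X v q)%:R).
Proof.
have Aq q : A root q = \sum_v (X v q)%:R.
  by apply: (subtree_sum_root (A := A^~ q)) => v; apply: A_rec.
have [mS _ mz] := moments (erefl (lev root)).
have dotA y : dot (fun q => \sum_v (X v q)%:R : R) y = dot (A root) y.
  by apply: eq_bigr => q _; rewrite Aq.
have skA w : sketch (fun q => \sum_v (X v q)%:R) w = sketch (A root) w.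
  by apply: eq_bigr => q _; rewrite Aq.
rewrite dotA dotC dotA.
rewrite (@eq_Ex _ _ _ (fun w => ((z root w)%:~R * (z root w)%:~R +
   sketch (A root) w * sketch (A root) w) +
   - ((z root w)%:~R * sketch (A root) w +
      (z root w)%:~R * sketch (A root) w))); last first.
  by move=> w; rewrite skA; ring.
rewrite !ExD ExN !ExD !mS Ex_sketch.
by move: mz; rewrite dist_refl subn0 => mz; lra.
Qed.

Lemma root_second_moment :
  Ex (fun w => (z root w)%:~R ^+ 2) <=
  growth ^+ D * dot (fun q => \sum_v (X v q)%:R : R) (fun q => \sum_v (X v q)%:R).
Proof.
have [_ _] := moments (erefl (lev root)).
rewrite dist_refl subn0; congr (_ <= _ * _); apply: eq_bigr => q _.
by rewrite (subtree_sum_root (A := A^~ q) (X := fun v => (X v q)%:R)) // => v; apply: A_rec.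
Qed.

End Tree.

(** * Sketched matrix products *)

Section Sketch.
Variables (R : realType) (I : finType) (k n : nat) (sc : 'I_k -> 'I_n -> I).
Hypothesis sc_inj : forall r q r' q', sc r q = sc r' q' -> r = r' /\ q = q'.
Variables (x y : 'I_n -> R).
Notation Omega := (#|I|.-tuple bool).

(* [sketch x * sketch y - dot x y] is the sum of [s_q] times the sketch of [past q],
   which only involves the signs before [s_q]: a sum of orthogonal variables. *)
Definition past (q p : 'I_n) : R := if (p < q)%N then y q * x p + x q * y p else 0.

(** The double sum is split into [p = q], [p < q] and [q < p]; the last part is transposed onto the
    second. *)
Lemma sketch_mulE r w : sketch (sc r) x w * sketch (sc r) y w =
  dot x y + \sum_q sgn R w (sc r q) * sketch (sc r) (past q) w.
Proof.
pose F p q := (sgn R w (sc r p) * x p) * (sgn R w (sc r q) * y q).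
have -> : sketch (sc r) x w * sketch (sc r) y w = \sum_q \sum_p F p q.
  by rewrite mulr_sumr; apply: eq_bigr => q _; rewrite mulr_suml.
have split3 q p : F p q = (if p == q then F p q else 0) +
    ((if (p < q)%N then F p q else 0) + (if (q < p)%N then F p q else 0)).
  by rewrite -(inj_eq val_inj) /=; case: ltngtP; rewrite ?addr0 ?add0r.
under eq_bigr => q _ do under eq_bigr => p _ do rewrite split3.
under eq_bigr => q _ do rewrite big_split /=.
rewrite big_split /=; congr (_ + _).
  apply: eq_bigr => q _; rewrite (bigD1 q) //= eqxx big1 ?addr0 => [|p /negbTE -> //].
  by rewrite /F mulrACA sgn_sq mul1r.
under eq_bigr => q _ do rewrite big_split /=.
rewrite big_split /= [X in _ + X]exchange_big -big_split /=.
apply: eq_bigr => q _; rewrite -big_split mulr_sumr /=; apply: eq_bigr => p _.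
rewrite /past /F; case: ifP => _; last by rewrite !mulr0 addr0.
ring.
Qed.

Lemma past_orth (r r' : 'I_k) (q q' : 'I_n) : (r, q) != (r', q') ->
  Ex (fun w => (sgn R w (sc r q) * sketch (sc r) (past q) w) *
    (sgn R w (sc r' q') * sketch (sc r') (past q') w)) = 0.
Proof.
(* In this case the sign of [(r1, q1)] occurs nowhere else in the product. The remaining case
   follows by exchanging the factors. *)
have key (r1 r2 : 'I_k) (q1 q2 : 'I_n) : (r1 != r2) || (q2 < q1)%N ->
  Ex (fun w => (sgn R w (sc r1 q1) * sketch (sc r1) (past q1) w) *
    (sgn R w (sc r2 q2) * sketch (sc r2) (past q2) w)) = 0.
  move=> h; under eq_Ex do rewrite -mulrA.
  have ne (p : 'I_n) : (r1 != r2) || (p < q1)%N -> sc r2 p != sc r1 q1.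
    move=> hp; apply/eqP => /sc_inj [e1 e2]; move: hp.
    by rewrite e1 e2 eqxx ltnn.
  apply: Ex_sgn0 => w; rewrite sgn_indep ?ne //; congr (_ * (_ * _)).
    apply: eq_bigr => p _; rewrite /past; case: ifP => pq; last by rewrite !mulr0.
    rewrite sgn_indep //; apply/eqP => /sc_inj [_ e].
    by rewrite e ltnn in pq.
  apply: eq_bigr => p _; rewrite /past; case: ifP => pq; last by rewrite !mulr0.
  rewrite sgn_indep // ne //.
  by case/orP: h => [->//|h]; rewrite (ltn_trans pq h) orbT.
rewrite xpair_eqE negb_and => h; have [hq|hq|hq] := ltngtP q q'.
- under eq_Ex do rewrite mulrC.
  by apply: key; rewrite hq orbT.
- by apply: key; rewrite hq orbT.
by apply: key; move: h; rewrite (val_inj hq) eqxx orbF => ->.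
Qed.

(** Uses [(a + b) ^ 2 <= 2 a ^ 2 + 2 b ^ 2]; the two halves then cover each off-diagonal pair
    once. *)
Lemma past_sum : \sum_q dot (past q) (past q) <= 2 * (dot x x * dot y y).
Proof.
pose F p q : R := (x p * x p) * (y q * y q).
have -> : dot x x * dot y y = \sum_q \sum_p F p q.
  by rewrite mulr_sumr; apply: eq_bigr => q _; rewrite mulr_suml.
have F0 p q : 0 <= F p q by rewrite mulr_ge0 // -expr2 sqr_ge0.
pose L : R := \sum_(q < n) \sum_(p < n) 2 * ((if (p < q)%N then F p q else 0) +
    (if (p < q)%N then F q p else 0)).
apply: (@le_trans _ _ L); rewrite /L.
  apply: ler_sum => q _; apply: ler_sum => p _; rewrite /past /F.
  case: ifP => _; last by rewrite !mulr0 addr0 mulr0.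
  have := sqr_ge0 (y q * x p - x q * y p); rewrite expr2; lra.
under eq_bigr do rewrite -mulr_sumr big_split /=.
rewrite -mulr_sumr ler_pM2l // big_split /= [X in _ + X]exchange_big -big_split /=.
apply: ler_sum => q _; rewrite -big_split /=; apply: ler_sum => p _.
by case: ltngtP; rewrite ?addr0 ?add0r.
Qed.

(** By orthogonality over all pairs (row, column) the variance is [k] times the sum of the squared
    norms of [past q]. *)
Lemma Ex_sketch_product :
  Ex (fun w => (\sum_r sketch (sc r) x w * sketch (sc r) y w - k%:R * dot x y) ^+ 2)
  <= 2 * k%:R * (dot x x * dot y y).
Proof.
pose H (t : 'I_k * 'I_n) w := sgn R w (sc t.1 t.2) * sketch (sc t.1) (past t.2) w.
rewrite (@eq_Ex _ _ _ (fun w => \sum_t \sum_t' H t w * H t' w)); last first.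
  move=> w; under [in LHS]eq_bigr do rewrite sketch_mulE.
  rewrite big_split /= sumr_const card_ord mulr_natl addrAC subrr add0r.
  rewrite pair_bigA /= expr2 mulr_suml; apply: eq_bigr => t _.
  by rewrite mulr_sumr.
rewrite Ex_sum (eq_bigr (fun t => dot (past t.2) (past t.2))).
  rewrite -(pair_bigA _ (fun _ q => dot (past q) (past q))) /= sumr_const card_ord.
  rewrite -[leLHS]mulr_natl [leRHS](_ : _ = k%:R * (2 * (dot x x * dot y y))); last by ring.
  by rewrite ler_wpM2l ?past_sum.
move=> t _; rewrite Ex_sum (bigD1 t) //= big1 ?addr0.
  rewrite /H; under eq_Ex do rewrite mulrACA sgn_sq mul1r.
  by rewrite Ex_sketch // => q q' /sc_inj [].
by move=> t' tt'; apply: past_orth; rewrite -!surjective_pairing eq_sym.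
Qed.

End Sketch.

(** * Inequalities for Frobenius norms *)

Section Frobenius.
Variable R : realType.

Lemma Cauchy_Schwarz_sum (J : finType) (u v : J -> R) :
  (\sum_r u r * v r) ^+ 2 <= (\sum_r u r ^+ 2) * (\sum_r v r ^+ 2).
Proof.
rewrite -(ler_pM2l (x := 2)) // -subr_ge0.
(* Lagrange's identity. *)
suff -> : 2 * ((\sum_r u r ^+ 2) * (\sum_r v r ^+ 2)) - 2 * (\sum_r u r * v r) ^+ 2
    = \sum_r \sum_r' (u r * v r' - u r' * v r) ^+ 2.
  by apply: sumr_ge0 => r _; apply: sumr_ge0 => r' _; apply: sqr_ge0.
have e1 : (\sum_r u r ^+ 2) * (\sum_r v r ^+ 2) = \sum_r \sum_r' u r ^+ 2 * v r' ^+ 2.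
  by rewrite mulr_suml; apply: eq_bigr => r _; rewrite mulr_sumr.
have e2 : (\sum_r u r * v r) ^+ 2 = \sum_r \sum_r' (u r * v r) * (u r' * v r').
  by rewrite expr2 mulr_suml; apply: eq_bigr => r _; rewrite mulr_sumr.
have e1' : (\sum_r u r ^+ 2) * (\sum_r v r ^+ 2) = \sum_r \sum_r' u r' ^+ 2 * v r ^+ 2.
  by rewrite e1 exchange_big.
rewrite [X in X - _]mulr_natl mulr2n {1}e1 e1' e2.
rewrite mulr_sumr -big_split -sumrB /=; apply: eq_bigr => r _.
rewrite mulr_sumr -big_split -sumrB /=; apply: eq_bigr => r' _.
ring.
Qed.

Lemma sum_sqr_product_le (J A B : finType) (u : J -> A -> R) (v : J -> B -> R) :
  \sum_a \sum_b (\sum_r u r a * v r b) ^+ 2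
  <= (\sum_r \sum_a u r a ^+ 2) * (\sum_r \sum_b v r b ^+ 2).
Proof.
rewrite [X in _ <= X * _]exchange_big [X in _ <= _ * X]exchange_big mulr_suml /=.
apply: ler_sum => a _.
by rewrite mulr_sumr; apply: ler_sum => b _; apply: Cauchy_Schwarz_sum.
Qed.

Lemma perturbed_product (J A B : finType) (zX sX : J -> A -> R)
    (zY sY : J -> B -> R) (P : A -> B -> R) :
  \sum_a \sum_b (\sum_r zX r a * zY r b - P a b) ^+ 2 <=
  3 * (\sum_a \sum_b (\sum_r sX r a * sY r b - P a b) ^+ 2
    + (\sum_r \sum_a (zX r a - sX r a) ^+ 2) * (\sum_r \sum_b zY r b ^+ 2)
    + (\sum_r \sum_a sX r a ^+ 2) * (\sum_r \sum_b (zY r b - sY r b) ^+ 2)).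
Proof.
have h1 := sum_sqr_product_le (fun r a => zX r a - sX r a) zY.
have h2 := sum_sqr_product_le sX (fun r b => zY r b - sY r b).
apply: (@le_trans _ _ (3 * (\sum_a \sum_b (\sum_r sX r a * sY r b - P a b) ^+ 2
    + \sum_a \sum_b (\sum_r (zX r a - sX r a) * zY r b) ^+ 2
    + \sum_a \sum_b (\sum_r sX r a * (zY r b - sY r b)) ^+ 2))); last first.
  by rewrite ler_pM2l //; apply: lerD h2; rewrite lerD2l; apply: h1.
rewrite -!big_split mulr_sumr; apply: ler_sum => a _ /=.
rewrite -!big_split mulr_sumr; apply: ler_sum => b _ /=.
(* Sketching error, rounding error of the first factor, rounding error of the second; the factor 3
   comes from squaring a sum of three terms. *)
have -> : \sum_r zX r a * zY r b - P a b = (\sum_r sX r a * sY r b - P a b) +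
    (\sum_r (zX r a - sX r a) * zY r b) + \sum_r sX r a * (zY r b - sY r b).
  rewrite -addrA -big_split addrAC -big_split /=; congr (_ - _).
  by apply: eq_bigr => r _; ring.
set p := _ - _; set q := \sum_r _; set t := \sum_r _.
have := sqr_ge0 (p - q); have := sqr_ge0 (q - t); have := sqr_ge0 (p - t).
by rewrite !expr2; lra.
Qed.

End Frobenius.

(** * The protocol *)

Section Floats.
Variables (s B : nat).

(** Sign, mantissa and exponent. The form [.-1.+1] exposes the successor that [inord] asks for. *)
Definition float := (bool * 'I_(2 ^ s.+2).-1.+1 * 'I_B.+1)%type.

Definition float_val (f : float) : int := (-1) ^+ f.1.1 * (f.1.2 * 2 ^ f.2)%N%:Z.

Definition float_round (z : int) (c : nat -> bool) : float :=
  (z < 0, inord (halve `|z| c (expo s `|z|)), inord (expo s `|z|)).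

Lemma float_roundK z c : (expo s `|z| <= B)%N ->
  float_val (float_round z c) = round_int s z c.
Proof.
move=> zB; rewrite /float_val /float_round /round_int /round_nat /=.
have qB : (halve `|z| c (expo s `|z|) < (2 ^ s.+2).-1.+1)%N.
  by rewrite prednK ?expn_gt0 // mantissa_lt.
have eB : (expo s `|z| < B.+1)%N by [].
rewrite (inordK qB) (inordK eB).
case: (sgzP z) => [->|z0|z0]; rewrite ?expr0 ?expr1 //.
Qed.

Lemma card_float : #|{: float}| = (2 ^ s.+3 * B.+1)%N.
Proof. by rewrite !card_prod card_bool !card_ord prednK ?expn_gt0 // -expnS. Qed.

End Floats.

(** The factor 20 is that of Markov's inequality. The sketching part is [3 * 40 k = 120 k], half the
    budget once [eps2 * k >= 240]; the rounding part is [1200 (g - 1) (g + 1) k ^ 2], the other half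
    since [g + 1 <= 3] and [7200 = 2 * 3 * 1200]. *)
Lemma error_budget (R : realType) (eps2 k g x2 y2 f1 f2 f3 f4 f5 : R) :
  0 <= eps2 -> eps2 < 1 -> 0 < k -> 0 <= x2 -> 0 <= y2 -> 1 <= g ->
  0 <= f2 -> 0 <= f3 -> 0 <= f4 -> 0 <= f5 ->
  240 <= eps2 * k -> g - 1 <= eps2 / 7200 ->
  f1 <= 20 * (2 * k * (x2 * y2)) -> f2 <= 20 * (1 * k * x2) ->
  f3 <= 20 * (g * k * y2) -> f4 <= 20 * ((g - 1) * k * x2) ->
  f5 <= 20 * ((g - 1) * k * y2) ->
  3 * (f1 + f4 * f3 + f2 * f5) <= k ^+ 2 * (eps2 * x2 * y2).
Proof.
move=> e0 e1 k0 x0 y0 g1 p2 p3 p4 p5 keps geps h1 h2 h3 h4 h5.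
have m1 := ler_pM p4 p3 h4 h3; have m2 := ler_pM p2 p5 h2 h5.
move: {p2 p3 p4 p5 h2 h3 h4 h5} m1 m2; set m1 := f4 * f3; set m2 := f2 * f5 => m1le m2le.
apply: (@le_trans _ _ ((120 * k + 1200 * ((g - 1) * (g + 1)) * k ^+ 2) * (x2 * y2))).
  by clear - h1 m1le m2le; lra.
have -> : k ^+ 2 * (eps2 * x2 * y2) = (k ^+ 2 * eps2) * (x2 * y2) by ring.
apply: ler_wpM2r; first exact: mulr_ge0.
have k1 : 120 * k <= (k ^+ 2 * eps2) / 2.
  by have := ler_wpM2r (ltW k0) keps; clear; rewrite expr2; lra.
have gg : (g - 1) * (g + 1) <= eps2 / 7200 * 3.
  by apply: ler_pM => //; clear - g1 e0 e1 geps; lra.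
have k2 : 1200 * ((g - 1) * (g + 1)) <= eps2 / 2 by clear - gg e0; lra.
by have := ler_wpM2r (sqr_ge0 k) k2; clear - k1; lra.
Qed.

Section Protocol.
Variables (R : realType) (n m M t1 t2 : nat) (G : rel 'I_m) (root : 'I_m).
Hypotheses (Gs : symmetric G) (Gc : connected_graph G).
Variables (k s e D : nat).
Hypothesis lev_le : forall v, (dist G root v <= D)%N.
Hypothesis e_large : (trunc_log 2 (n * M * (2 * m).+1 ^ D) < 2 ^ e)%N.
Hypothesis size_gt0 : (0 < k * (t1 + t2))%N.

Notation lev := (dist G root).
Notation child := (child G root).
Notation input := ('M['I_M.+1]_(n, t1) * 'M['I_M.+1]_(n, t2))%type.

Definition entry : finType := ('I_k * ('I_t1 + 'I_t2))%type.
(** Exponents from 0 to [max_expo] fill exactly [e] bits. *)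
Definition max_expo := (2 ^ e).-1.
(** The sign coins are common to all players; the rounding coins are separate for each vertex and
    entry. Both come from the public string. *)
Definition coin_index : finType := ('I_k * 'I_n + 'I_m * entry * 'I_max_expo.+1)%type.
Definition message : finType := {ffun entry -> float s max_expo}.

Notation Omega := (#|coin_index|.-tuple bool).
Notation state := {ffun entry -> int}.

Definition sign_coin (r : 'I_k) (q : 'I_n) : coin_index := inl (r, q).
Definition round_coin (a : entry) (v : 'I_m) (i : nat) : coin_index := inr (v, a, inord i).

Definition input_entry (x : input) (c : 'I_t1 + 'I_t2) (q : 'I_n) : nat :=
  match c with inl a => x.1 q a | inr b => x.2 q b end.

Definition own_state (x : input) (w : Omega) : state :=
  [ffun a : entry => \sum_q (-1) ^+ coin w (sign_coin a.1 q) * (input_entry x a.2 q)%:Z].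

Definition to_message (v : 'I_m) (w : Omega) (z : state) : message :=
  [ffun a : entry => float_round s max_expo (z a) (coin w \o round_coin a v)].

Definition of_message (t : message) : state := [ffun a : entry => float_val (t a)].

Definition product_estimate (z : state) : 'M[R]_(t1, t2) :=
  \matrix_(a, b) ((\sum_(r < k) (z (r, inl a))%:~R * (z (r, inr b))%:~R) / k%:R).

Definition message_bits := ((s.+3 + e) * (k * (t1 + t2)))%N.

Lemma card_message : (#|message| <= 2 ^ message_bits)%N.
Proof.
rewrite card_ffun card_float prednK ?expn_gt0 // -expnD.
by rewrite card_prod card_sum !card_ord -expnM.
Qed.

Lemma message_bits_gt0 : (0 < message_bits)%N.
Proof. by rewrite muln_gt0 addSn. Qed.

Definition sketch_protocol : protocol G input 'M[R]_(t1, t2) :=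
  convergecast root Gs Gc card_message message_bits_gt0 of_message
    (fun v x w z => to_message v w (own_state x w + z))
    (fun x w z => product_estimate (own_state x w + z)).

Variables (X : 'I_m -> 'M['I_M.+1]_(n, t1)) (Y : 'I_m -> 'M['I_M.+1]_(n, t2)).
Notation inputs := (fun i => (X i, Y i)).

Definition node_state (w : Omega) : 'I_m -> state :=
  tree_fold G root (fun v => own_state (X v, Y v) w)
    (fun c z => of_message (to_message c w z)) D.

Lemma node_stateE w v : node_state w v = own_state (X v, Y v) w +
  \sum_(c | child c v) of_message (to_message c w (node_state w c)).
Proof. exact: tree_foldE. Qed.

Definition node_message (w : Omega) (v : 'I_m) : message := to_message v w (node_state w v).

Lemma node_message_local w v : v != root ->
  node_message w v = to_message v w
    (own_state (X v, Y v) w + \sum_(c | child c v) of_message (node_message w c)).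
Proof. by rewrite /node_message [in LHS]node_stateE. Qed.

Lemma output_sketch_protocol w :
  output_at (P := sketch_protocol) inputs w root = product_estimate (node_state w root).
Proof.
rewrite node_stateE.
exact: (output_convergecast Gs Gc card_message message_bits_gt0
  (fun x w z => product_estimate (own_state x w + z))
  (local := fun v x w z => to_message v w (own_state x w + z))
  (x := inputs) (M := node_message w) (node_message_local w)).
Qed.

Lemma max_comm_sketch_protocol w :
  (max_comm (P := sketch_protocol) inputs w <= 2 * message_bits)%N.
Proof.
exact: (max_comm_convergecast Gs Gc card_message message_bits_gt0
  (fun x w z => product_estimate (own_state x w + z))
  (local := fun v x w z => to_message v w (own_state x w + z))
  (x := inputs) (M := node_message w) (node_message_local w)).
Qed.

Lemma expo_bounded z h : (h <= D)%N ->
  `|z| <= (n * M * (2 * m).+1 ^ h)%N%:Z -> (expo s `|z| <= max_expo)%N.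
Proof.
move=> hD zle; rewrite -ltnS /max_expo prednK ?expn_gt0 //.
apply: leq_ltn_trans e_large; apply: leq_trans (leq_subr _ _) _.
apply: leq_trunc_log; rewrite -lez_nat abszE; apply: le_trans zle _.
by rewrite lez_nat leq_mul2l leq_pexp2l ?orbT.
Qed.

Lemma of_to_message c w (z : state) a h : (h <= D)%N ->
  `|z a| <= (n * M * (2 * m).+1 ^ h)%N%:Z ->
  of_message (to_message c w z) a = round_int s (z a) (coin w \o round_coin a c).
Proof. by move=> hD zle; rewrite !ffunE float_roundK // (expo_bounded hD). Qed.

(** Rounding at most doubles a value, there are at most [m] children, and the own part is at most
    [n * M]: each level costs a factor [2 * m + 1]. The bound on the children ensures that their
    exponents fit into a message, which the induction needs. *)
Lemma node_state_bound w v a :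
  `|node_state w v a| <= (n * M * (2 * m).+1 ^ (D - lev v))%N%:Z.
Proof.
set b := (n * M)%N; set p := (2 * m).+1.
have own_le u : `|own_state (X u, Y u) w a| <= b%:Z.
  rewrite ffunE; apply: le_trans (ler_norm_sum _ _ _) _.
  apply: (@le_trans _ _ (\sum_(q < n) M%:Z)); last first.
    by rewrite sumr_const card_ord /b PoszM -mulr_natl natz.
  apply: ler_sum => q _; rewrite normrM normrX normrN1 expr1n mul1r.
  rewrite ger0_norm // lez_nat /input_entry.
  by case: a.2 => c; rewrite -ltnS.
have base u : (D - lev u = 0)%N ->
    `|node_state w u a| <= (b * p ^ (D - lev u))%N%:Z.
  move=> D0; rewrite node_stateE ffunE big_pred0 => [|c]; last first.
    by apply/negP => /(child_lev Gs Gc) ec; have := lev_le c; lia.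
  by rewrite [X in _ + X]ffunE addr0 D0 expn0 muln1.
move: {2}(D - lev v)%N (leqnn (D - lev v)) => h.
elim: h v => [|h IH] v hv; first by apply: base; lia.
have [D0|D1] := posnP (D - lev v)%N; first exact: base.
rewrite node_stateE ffunE; apply: le_trans (ler_normD _ _) _; rewrite sum_ffunE.
have -> : (D - lev v)%N = (D - (lev v).+1).+1 by lia.
set h' := (D - (lev v).+1)%N; set y := (b * p ^ h')%N.
have sum_le : `|\sum_(c | child c v) of_message (to_message c w (node_state w c)) a|
    <= (m * (2 * y))%N%:Z.
  apply: le_trans (ler_norm_sum _ _ _) _.
  apply: (@le_trans _ _ (\sum_(c < m) (2 * y)%N%:Z)); last first.
    by rewrite sumr_const card_ord [leRHS]PoszM -mulr_natl natz.
  rewrite [leLHS]big_mkcond /=; apply: ler_sum => c _.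
  case: ifP => // /(child_lev Gs Gc) ec.
  have cle : `|node_state w c a| <= y%:Z by rewrite /y /h' -ec; apply: IH; lia.
  rewrite (of_to_message _ _ _ cle) ?leq_subr //.
  by apply: le_trans (round_int_le _ _ _) _; rewrite PoszM ler_pM2l.
apply: le_trans (lerD (own_le v) sum_le) _.
have b_le : (b <= y)%N by rewrite leq_pmulr // expn_gt0.
by rewrite -PoszD lez_nat expnS [X in (_ <= X)%N]mulnCA -/y mulnCA mulnA mulSn leq_add2r.
Qed.

Definition total_entry (c : 'I_t1 + 'I_t2) (q : 'I_n) : R :=
  \sum_v (input_entry (X v, Y v) c q)%:R.

Definition signed_sum (a : entry) : Omega -> R :=
  sketch (sign_coin a.1) (total_entry a.2).

Definition growth_factor : R := growth R s ^+ D.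

Lemma sign_coin_inj r q r' q' : sign_coin r q = sign_coin r' q' -> r = r' /\ q = q'.
Proof. by case. Qed.

Lemma round_coin_inj a c c' i i' : (i < max_expo)%N -> (i' < max_expo)%N ->
  round_coin a c i = round_coin a c' i' -> c = c' /\ i = i'.
Proof.
move=> hi hi' [-> /(congr1 val)] /=.
by rewrite !inordK ?(ltn_trans _ (ltnSn _)).
Qed.

Definition subtree_entry (a : entry) (v : 'I_m) (q : 'I_n) : R :=
  tree_fold G root (fun v => (input_entry (X v, Y v) a.2 q)%:R) (fun _ x => x) D v.

Lemma node_error a :
  Ex (fun w => ((node_state w root a)%:~R - signed_sum a w) ^+ 2) <=
    (growth_factor - 1) * dot (total_entry a.2) (total_entry a.2) /\
  Ex (fun w => (node_state w root a)%:~R ^+ 2) <=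
    growth_factor * dot (total_entry a.2) (total_entry a.2).
Proof.
have A_rec v q : subtree_entry a v q = (input_entry (X v, Y v) a.2 q)%:R +
    \sum_(c | child c v) subtree_entry a c q by apply: tree_foldE.
have z_rec v w : node_state w v a =
    \sum_q (-1) ^+ coin w (sign_coin a.1 q) * (input_entry (X v, Y v) a.2 q)%:Z +
    \sum_(c | child c v) rounded s (round_coin a) (fun v w => node_state w v a) c w.
  rewrite node_stateE ffunE sum_ffunE; congr (_ + _); first by rewrite ffunE.
  by apply: eq_bigr => c _; rewrite (of_to_message _ _ _ (node_state_bound w c a)) ?leq_subr.
have z_expo v w : (expo s `|node_state w v a| <= max_expo)%N.
  by apply: expo_bounded (node_state_bound w v a); rewrite leq_subr.
have s_inj : injective (sign_coin a.1) by move=> q q' [].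
have sr c i q : (i < max_expo)%N -> round_coin a c i != sign_coin a.1 q by [].
split.
  exact: (root_error Gs Gc s_inj (@round_coin_inj a) sr lev_le A_rec z_rec z_expo).
exact: (root_second_moment Gs Gc s_inj (@round_coin_inj a) sr lev_le A_rec z_rec z_expo).
Qed.

Lemma Ex_signed_sum a :
  Ex (fun w => signed_sum a w ^+ 2) = dot (total_entry a.2) (total_entry a.2).
Proof. by apply: Ex_sketch => q q' []. Qed.

Notation XX := (sum_inputs R X).
Notation YY := (sum_inputs R Y).

Lemma total_entry_inl a q : total_entry (inl a) q = XX q a.
Proof. by rewrite /total_entry summxE; apply: eq_bigr => v _; rewrite mxE. Qed.

Lemma total_entry_inr b q : total_entry (inr b) q = YY q b.
Proof. by rewrite /total_entry summxE; apply: eq_bigr => v _; rewrite mxE. Qed.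

Lemma frobenius_ge0 a b (A : 'M[R]_(a, b)) : 0 <= frobenius A.
Proof. exact: sqrtr_ge0. Qed.

Lemma frobenius_sqr a b (A : 'M[R]_(a, b)) : frobenius A ^+ 2 = \sum_i \sum_j A i j ^+ 2.
Proof.
by rewrite sqr_sqrtr //; apply: sumr_ge0 => i _; apply: sumr_ge0 => j _; apply: sqr_ge0.
Qed.

Lemma sum_dot_inl : \sum_a dot (total_entry (inl a)) (total_entry (inl a)) = frobenius XX ^+ 2.
Proof.
rewrite frobenius_sqr exchange_big /=; apply: eq_bigr => a _; apply: eq_bigr => q _.
by rewrite total_entry_inl expr2.
Qed.

Lemma sum_dot_inr : \sum_b dot (total_entry (inr b)) (total_entry (inr b)) = frobenius YY ^+ 2.
Proof.
rewrite frobenius_sqr exchange_big /=; apply: eq_bigr => a _; apply: eq_bigr => q _.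
by rewrite total_entry_inr expr2.
Qed.

Lemma product_entry a b :
  (XX^T *m YY) a b = dot (total_entry (inl a)) (total_entry (inr b)).
Proof.
by rewrite mxE; apply: eq_bigr => q _; rewrite mxE total_entry_inl total_entry_inr.
Qed.

Lemma mul_sum_sum (A A' : finType) (c : R) (f : A -> R) (g : A' -> R) :
  c * ((\sum_a f a) * (\sum_b g b)) = \sum_a \sum_b c * (f a * g b).
Proof.
rewrite mulr_suml mulr_sumr; apply: eq_bigr => a _.
by rewrite mulr_sumr mulr_sumr.
Qed.

Lemma Ex_sum_le (A : finType) (i : A -> 'I_t1 + 'I_t2) (g : R)
    (f : entry -> Omega -> R) :
  (forall a, Ex (f a) <= g * dot (total_entry a.2) (total_entry a.2)) ->
  Ex (fun w => \sum_r \sum_a f (r, i a) w) <=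
  g * k%:R * \sum_a dot (total_entry (i a)) (total_entry (i a)).
Proof.
move=> fle; rewrite Ex_sum (mulrC g) -mulrA mulr_natl -[X in _ *+ X]card_ord -sumr_const.
apply: ler_sum => r _; rewrite Ex_sum mulr_sumr; apply: ler_sum => a _.
exact: fle.
Qed.

Lemma growth_factor_ge1 : 1 <= growth_factor.
Proof. exact/exprn_ege1/growth_ge1. Qed.

(** Markov's inequality is applied to five quantities, each failing with probability at most 1/20;
    outside the union, of probability at most 1/4, the bound is deterministic. *)
Lemma accuracy (eps : R) : 0 < eps -> eps < 1 -> 240 <= eps ^+ 2 * k%:R ->
  growth_factor - 1 <= eps ^+ 2 / 7200 ->
  3 / 4 <= uniform_prob R (fun w : (coins sketch_protocol).-tuple bool =>
    frobenius (output_at inputs w root - XX^T *m YY)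
      <= eps * frobenius XX * frobenius YY).
Proof.
move=> eps0 eps1 keps geps.
set x2 := frobenius XX ^+ 2; set y2 := frobenius YY ^+ 2.
have x20 : 0 <= x2 by apply: sqr_ge0.
have y20 : 0 <= y2 by apply: sqr_ge0.
have eps2 : eps ^+ 2 < 1 by rewrite expr_lt1 // ltW.
have g2 : growth_factor <= 2 by lra.
have k0 : 0 < k%:R :> R.
  rewrite lt_neqAle ler0n andbT; apply/eqP => kz; move: keps; rewrite -kz mulr0; lra.
pose zX w r a : R := (node_state w root (r, inl a))%:~R.
pose zY w r b : R := (node_state w root (r, inr b))%:~R.
pose sX w r a := signed_sum (r, inl a) w.
pose sY w r b := signed_sum (r, inr b) w.
pose P a b := k%:R * dot (total_entry (inl a)) (total_entry (inr b)).
(* [f1] is the sketching error, [f2] and [f3] are sizes of sketches, [f4] and [f5] the rounding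
   errors. *)
pose f1 w := \sum_a \sum_b (\sum_r sX w r a * sY w r b - P a b) ^+ 2.
pose f2 w := \sum_r \sum_a sX w r a ^+ 2.
pose f3 w := \sum_r \sum_b zY w r b ^+ 2.
pose f4 w := \sum_r \sum_a (zX w r a - sX w r a) ^+ 2.
pose f5 w := \sum_r \sum_b (zY w r b - sY w r b) ^+ 2.
have E1 : Ex f1 <= 2 * k%:R * (x2 * y2).
  rewrite Ex_sum /x2 /y2 -sum_dot_inl -sum_dot_inr mul_sum_sum.
  apply: ler_sum => a _; rewrite Ex_sum; apply: ler_sum => b _.
  exact: (Ex_sketch_product sign_coin_inj (total_entry (inl a)) (total_entry (inr b))).
have E2 : Ex f2 <= 1 * k%:R * x2.
  rewrite /x2 -sum_dot_inl; apply: (Ex_sum_le inl (f := fun a w => signed_sum a w ^+ 2)) => a.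
  by rewrite Ex_signed_sum mul1r.
have E3 : Ex f3 <= growth_factor * k%:R * y2.
  rewrite /y2 -sum_dot_inr.
  apply: (Ex_sum_le inr (f := fun a w => (node_state w root a)%:~R ^+ 2)) => a.
  by case: (node_error a).
have E4 : Ex f4 <= (growth_factor - 1) * k%:R * x2.
  rewrite /x2 -sum_dot_inl; apply: (Ex_sum_le inl
    (f := fun a w => ((node_state w root a)%:~R - signed_sum a w) ^+ 2)) => a.
  by case: (node_error a).
have E5 : Ex f5 <= (growth_factor - 1) * k%:R * y2.
  rewrite /y2 -sum_dot_inr; apply: (Ex_sum_le inr
    (f := fun a w => ((node_state w root a)%:~R - signed_sum a w) ^+ 2)) => a.
  by case: (node_error a).
have ss0 (A B : finType) (h : A -> B -> R) : 0 <= \sum_a \sum_b h a b ^+ 2.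
  by apply: sumr_ge0 => a _; apply: sumr_ge0 => b _; apply: sqr_ge0.
have c20 : 0 < 20 :> R by [].
have p1 := prob_markov (fun w => ss0 _ _ _) E1 c20.
have p2 := prob_markov (fun w => ss0 _ _ _) E2 c20.
have p3 := prob_markov (fun w => ss0 _ _ _) E3 c20.
have p4 := prob_markov (fun w => ss0 _ _ _) E4 c20.
have p5 := prob_markov (fun w => ss0 _ _ _) E5 c20.
rewrite uniform_probC.
set bad := uniform_prob R (predC _).
suff : bad <= 1 / 4 by lra.
pose F (i : Omega -> R) (B : R) w := ~~ (i w <= 20 * B).
pose F1 : pred Omega := F f1 (2 * k%:R * (x2 * y2)).
pose F2 : pred Omega := F f2 (1 * k%:R * x2).
pose F3 : pred Omega := F f3 (growth_factor * k%:R * y2).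
pose F4 : pred Omega := F f4 ((growth_factor - 1) * k%:R * x2).
pose F5 : pred Omega := F f5 ((growth_factor - 1) * k%:R * y2).
have q12 := uniform_probU R F1 F2.
have q123 := uniform_probU R (predU F1 F2) F3.
have q45 := uniform_probU R F4 F5.
have qall := uniform_probU R (predU (predU F1 F2) F3) (predU F4 F5).
suff : bad <= uniform_prob R (predU (predU (predU F1 F2) F3) (predU F4 F5)).
  rewrite -/F1 in p1; rewrite -/F2 in p2; rewrite -/F3 in p3.
  rewrite -/F4 in p4; rewrite -/F5 in p5.
  move: p1 p2 p3 p4 p5 q12 q123 q45 qall.
  set u1 := uniform_prob R F1; set u2 := uniform_prob R F2; set u3 := uniform_prob R F3.
  set u4 := uniform_prob R F4; set u5 := uniform_prob R F5; lra.
apply: uniform_prob_sub => w; apply: contraR.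
change (~~ predU (predU (predU F1 F2) F3) (predU F4 F5) w ->
  frobenius (output_at (P := sketch_protocol) inputs w root - XX^T *m YY)
    <= eps * frobenius XX * frobenius YY).
rewrite output_sketch_protocol /= /F1 /F2 /F3 /F4 /F5 /F !negb_or !negbK.
move=> /andP[/andP[/andP[h1 h2] h3] /andP[h4 h5]].
rewrite -ler_sqr ?nnegrE ?frobenius_ge0 ?mulr_ge0 ?frobenius_ge0 ?(ltW eps0) //.
rewrite !exprMn -/x2 -/y2 frobenius_sqr.
have kk0 : 0 < k%:R ^+ 2 :> R by rewrite exprn_gt0.
rewrite -(ler_pM2l kk0).
apply: (@le_trans _ _ (\sum_a \sum_b (\sum_r zX w r a * zY w r b - P a b) ^+ 2)).
  rewrite le_eqVlt; apply/orP; left; apply/eqP.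
  rewrite mulr_sumr; apply: eq_bigr => a _; rewrite mulr_sumr; apply: eq_bigr => b _.
  have subE (U V : 'M[R]_(t1, t2)) : (U - V) a b = U a b - V a b by rewrite !mxE.
  rewrite subE product_entry mxE -exprMn /P; congr (_ ^+ 2).
  by rewrite mulrBr mulrCA divff ?gt_eqF // mulr1.
apply: le_trans (perturbed_product _ (sX w) _ (sY w) _) _.
rewrite -/(f1 w) -/(f2 w) -/(f3 w) -/(f4 w) -/(f5 w).
by apply: (error_budget (eps2 := eps ^+ 2) (g := growth_factor)) => //; try exact: ss0;
  rewrite ?sqr_ge0 ?growth_factor_ge1.
Qed.

End Protocol.

(** * Choice of the parameters *)

Section Numerics.
Variable R : realType.

(** From [ln (1 + x) <= x] at [x = -1/6] one gets [ln (6/5) >= 1/6], and [(6/5) ^ 6 < 3]. *)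
Lemma ln3_gt1 : 1 < ln (3 : R).
Proof.
have h : ln (5 / 6 : R) <= - (1 / 6).
  have -> : 5 / 6 = 1 + - (1 / 6) :> R by lra.
  by apply: le_ln1Dx; lra.
have h2 : 1 / 6 <= ln (6 / 5 : R).
  have -> : 6 / 5 = (5 / 6)^-1 :> R by field.
  by rewrite lnV ?posrE; lra.
have h3 : ln ((6 / 5 : R) ^+ 6) < ln 3.
  by rewrite ltr_ln ?posrE ?exprn_gt0 //; lra.
apply: le_lt_trans h3; rewrite lnXn; last lra.
by rewrite -(mulr_natl (ln _)); lra.
Qed.

Lemma lnln3_gt0 : 0 < ln (ln (3 : R)).
Proof. exact/ln_gt0/ln3_gt1. Qed.

Lemma ln2_gt0 : 0 < ln (2 : R).
Proof. by apply: ln_gt0; lra. Qed.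

Lemma poly_bound (c K : R) : exists p : nat, forall n N : nat, (3 <= n)%N ->
  N%:R <= K * n%:R `^ c -> (N <= n ^ p)%N.
Proof.
(* The constant [K] is absorbed as a power of [n], by [N < n ^ N]. *)
exists (Num.bound `|K| + Num.bound `|c|)%N => n N n3 hN.
have n1 : 1 <= n%:R :> R by rewrite ler1n; lia.
rewrite -(ler_nat R); apply: le_trans hN _; rewrite natrX exprD.
apply: (@le_trans _ _ (`|K| * n%:R `^ c)).
  by apply: ler_wpM2r; rewrite ?powR_ge0 // ler_norm.
apply: ler_pM; rewrite ?powR_ge0 //.
  apply: le_trans (ltW (archi_boundP (normr_ge0 K))) _.
  by rewrite -natrX ler_nat ltnW // ltn_expl //; lia.
rewrite -powR_mulrn ?(le_trans ler01) //; apply: ler_powR => //.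
apply: le_trans (ler_norm c) _; exact/ltW/archi_boundP.
Qed.

Lemma trunc_log_ln (x : nat) : (0 < x)%N -> (trunc_log 2 x)%:R * ln 2 <= ln x%:R :> R.
Proof.
move=> x0; rewrite mulr_natl -lnXn //.
rewrite ler_ln ?posrE ?exprn_gt0 ?ltr0n // -natrX ler_nat.
exact: trunc_logP.
Qed.

(** By induction [(1 + a) ^ E * (1 - E a) <= 1]; hence the power is at most 2, and putting this back
    gives the claim. *)
Lemma bernoulli_inv (a : R) (D : nat) : 0 <= a -> D%:R * a <= 1 / 2 ->
  (1 + a) ^+ D - 1 <= 2 * (D%:R * a).
Proof.
move=> a0 Da; have pos E : 0 <= (1 + a) ^+ E by apply: exprn_ge0; lra.
have h E : (1 + a) ^+ E * (1 - E%:R * a) <= 1.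
  elim: E => [|E IH]; first by rewrite expr0 mul0r subr0 mul1r.
  apply: le_trans IH; rewrite exprS mulrAC mulrC.
  apply: ler_wpM2l => //; rewrite -natr1.
  have : 0 <= E%:R * a * a by rewrite !mulr_ge0.
  by have := mulr_ge0 a0 a0; lra.
have hD := h D; have p1 : (1 + a) ^+ D <= 2.
  have := ler_wpM2l (pos D) Da; lra.
have : 0 <= D%:R * a by rewrite mulr_ge0.
move: hD; set g := (1 + a) ^+ D in p1 *; set b := D%:R * a in Da *.
move=> h1 b0; have := ler_wpM2r b0 p1; lra.
Qed.

(* Bounding the partial sums by [n M (2 m + 1)^D] is crude, but its logarithm is
   only [O(D log n)], and the exponents take the logarithm of that many bits. *)
Definition log_size (n p D : nat) : nat := ((trunc_log 2 n).+1 * (p.+1 * D.+1))%N.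

Lemma trunc_log_state n p m M D : (3 <= n)%N -> (0 < m)%N ->
  (m <= n ^ p)%N -> (M <= n ^ p)%N ->
  (trunc_log 2 (n * M * (2 * m).+1 ^ D) <= log_size n p D)%N.
Proof.
move=> n3 m0 mn Mn.
have le1 : (n * M * (2 * m).+1 ^ D <= n ^ (p.+1 * D.+1))%N.
  rewrite mulnS expnD mulnC [leqRHS]mulnC expnM; apply: leq_mul.
    case: D => [|D]; first by rewrite !expn0.
    (* [2 m + 1 <= 3 m <= n * n ^ p], by [m > 0] and [n >= 3]. *)
    rewrite leq_exp2r // expnS; apply: leq_trans (leq_mul n3 mn); lia.
  by rewrite expnS leq_mul2l Mn orbT.
apply: leq_trans (leq_trunc_log 2 le1) _.
have le2 : (n ^ (p.+1 * D.+1) <= 2 ^ log_size n p D)%N.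
  by rewrite /log_size [leqRHS]expnM leq_exp2r // ltnW // trunc_log_ltn.
by apply: leq_trans (leq_trunc_log 2 le2) _; rewrite trunc_expnK.
Qed.

Definition expo_bits n p D := (trunc_log 2 (log_size n p D)).+1.
(** Makes [2 ^ s >= 120 D / eps]. As [120 ^ 2 = 2 * 7200], the growth over [D] hops, doubled by
    [bernoulli_inv], stays within [eps ^ 2 / 7200]. The [maxn] covers the graph of diameter 0. *)
Definition precision (eps : R) D :=
  (trunc_log 2 (Num.truncn (120 * (maxn D 1)%:R / eps)).+1).+1.
Definition rows (eps : R) := (Num.truncn (240 / eps ^+ 2)).+1.

(* For [D = 0] this relies on the junk value [ln 0 = 0]. *)
Lemma ln_maxn D : ln (maxn D 1)%:R = ln D%:R :> R.
Proof.
case: D => [|D]; last by rewrite (maxn_idPl _).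
by rewrite (_ : maxn 0 1 = 1%N) // ln1 ln0.
Qed.

Lemma ln_nat_ge0 D : 0 <= ln D%:R :> R.
Proof. by rewrite -ln_maxn ln_ge0 // ler1n leq_max orbT. Qed.

Lemma expo_bits_large n p m M D : (3 <= n)%N -> (0 < m)%N ->
  (m <= n ^ p)%N -> (M <= n ^ p)%N ->
  (trunc_log 2 (n * M * (2 * m).+1 ^ D) < 2 ^ expo_bits n p D)%N.
Proof.
move=> n3 m0 mn Mn; apply: leq_ltn_trans (trunc_log_state _ n3 m0 mn Mn) _.
exact: trunc_log_ltn.
Qed.

Lemma expo_bits_le n p D : (3 <= n)%N ->
  (expo_bits n p D)%:R * ln 2 <=
    2 * ln 2 + ln (2 / ln 2) + ln p.+1%:R + ln (ln n%:R) + ln D%:R :> R.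
Proof.
move=> n3; have l2 := ln2_gt0.
have n0 : 0 < n%:R :> R by rewrite ltr0n; lia.
have lnn0 : 0 < ln n%:R :> R by apply: ln_gt0; rewrite ltr1n; lia.
have l0 : (0 < log_size n p D)%N by [].
rewrite /expo_bits -natr1 mulrDl mul1r.
have h1 := trunc_log_ln l0.
have eL : ln (log_size n p D)%:R =
    ln (trunc_log 2 n).+1%:R + (ln p.+1%:R + ln D.+1%:R) :> R.
  by rewrite /log_size !natrM !lnM ?posrE ?mulr_gt0 ?ltr0n.
(* As the binary logarithm is at least 1, adding 1 at most doubles it; the rest is a change of
   base. *)
have h2 : ln (trunc_log 2 n).+1%:R <= ln (2 / ln 2) + ln (ln n%:R) :> R.
  rewrite -lnM ?posrE ?divr_gt0 // ler_ln ?posrE ?ltr0n ?mulr_gt0 ?divr_gt0 ?invr_gt0 //.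
  have t1 : (1 <= trunc_log 2 n)%N by apply: (leq_trunc_log 2 (m := 2)); lia.
  have := trunc_log_ln (ltn_trans (isT : 0 < 2)%N n3).
  rewrite -ler_pdivlMr // => t2.
  apply: (@le_trans _ _ (2 * (trunc_log 2 n)%:R)).
    by rewrite -natr1 mulr_natl mulr2n lerD2l ler1n.
  by rewrite -mulrA [_ * ln _]mulrC ler_pM2l.
have h3 : ln D.+1%:R <= ln 2 + ln D%:R :> R.
  have m1 : 0 < (maxn D 1)%:R :> R by rewrite ltr0n leq_max orbT.
  rewrite -(ln_maxn D) -lnM ?posrE // ler_ln ?posrE ?mulr_gt0 //.
  by rewrite -natrM ler_nat maxnE; lia.
move: h1; rewrite eL; lra.
Qed.

Section Precision.
Variables (eps : R) (D : nat).
Hypotheses (eps0 : 0 < eps) (eps1 : eps < 1).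

Let D' : R := (maxn D 1)%:R.
Let D'1 : 1 <= D'.
Proof. by rewrite ler1n leq_max orbT. Qed.

Lemma precision_large : 120 * D' / eps <= 2 ^+ precision eps D.
Proof.
have := truncnS_gt (120 * D' / eps); set N := (Num.truncn _).+1 => h.
apply: le_trans (ltW h) _; rewrite -natrX ler_nat ltnW // /precision -/D' -/N.
exact: trunc_log_ltn.
Qed.

Lemma precision_le :
  (precision eps D)%:R * ln 2 <= ln 2 + ln 121 + ln D%:R + ln (1 / eps).
Proof.
rewrite /precision -natr1 mulrDl mul1r -/D'; set N := (Num.truncn _).
have h := trunc_log_ln (ltn0Sn N).
have De : 1 <= D' / eps by rewrite ler_pdivlMr // mul1r (le_trans (ltW eps1)).
have x0 : 0 <= 120 * D' / eps by rewrite -mulrA mulr_ge0 // (le_trans ler01).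
(* The successor is absorbed because [D' / eps >= 1]. *)
have hN : N.+1%:R <= 121 * (D' * (1 / eps)).
  have := truncn_le (120 * D' / eps); rewrite x0 => /idP; rewrite -/N => Nle.
  by rewrite -natr1 div1r; lra.
have e0 : 0 < 1 / eps by rewrite divr_gt0.
have D0 : 0 < D' by apply: lt_le_trans D'1.
have : ln N.+1%:R <= ln (121 * (D' * (1 / eps))) :> R.
  have p0 : 0 < 121 * (D' * (1 / eps)) by rewrite mulr_gt0 // mulr_gt0.
  by rewrite ler_ln ?posrE.
have -> : ln (121 * (D' * (1 / eps))) = ln 121 + (ln D%:R + ln (1 / eps)).
  by rewrite lnM ?posrE ?(mulr_gt0 D0 e0) // lnM ?posrE // ln_maxn.
lra.
Qed.

Lemma growth_precision : growth R (precision eps D) ^+ D - 1 <= eps ^+ 2 / 7200.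
Proof.
set s := precision eps D; have large : 120 * D' / eps <= 2 ^+ s := precision_large.
have D0 : 0 < D' by apply: lt_le_trans D'1.
have a_le : (4 ^+ s)^-1 <= (eps / (120 * D')) ^+ 2 :> R.
  have -> : (4 : R) = 2 ^+ 2 by rewrite expr2; lra.
  rewrite -exprM mulnC exprM -exprVn.
  rewrite ler_pXn2r ?nnegrE ?invr_ge0 ?divr_ge0 ?exprn_ge0 ?mulr_ge0 ?(ltW eps0) ?(ltW D0) //.
  by rewrite -[leRHS]invf_div lef_pV2 ?posrE ?exprn_gt0 // divr_gt0 // mulr_gt0.
have DD : D%:R <= D' by rewrite ler_nat leq_maxl.
have Da : D%:R * (4 ^+ s)^-1 <= eps ^+ 2 / 14400.
  apply: le_trans (ler_pM _ _ DD a_le) _; rewrite ?invr_ge0 ?exprn_ge0 //.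
  have -> : D' * (eps / (120 * D')) ^+ 2 = (eps ^+ 2 / 14400) / D' by field; rewrite gt_eqF.
  by rewrite ler_pdivrMr // ler_peMr // divr_ge0 ?sqr_ge0.
have eps2 : eps ^+ 2 < 1 by rewrite expr_lt1 // ltW.
have a0 : 0 <= (4 ^+ s)^-1 :> R by rewrite invr_ge0 exprn_ge0.
apply: le_trans (bernoulli_inv a0 _) _; clear - Da eps2; lra.
Qed.

Lemma rows_ge : 240 <= eps ^+ 2 * (rows eps)%:R.
Proof.
have := truncnS_gt (240 / eps ^+ 2); rewrite -/(rows eps) ltr_pdivrMr ?exprn_gt0 //.
by rewrite mulrC => /ltW.
Qed.

Lemma rows_le : (rows eps)%:R <= 241 * eps ^- 2.
Proof.
have e2 : 0 < eps ^+ 2 by rewrite exprn_gt0.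
have x0 : 0 <= 240 / eps ^+ 2 by rewrite divr_ge0 // ltW.
have := truncn_le (240 / eps ^+ 2); rewrite x0 => /idP h.
have e1 : 1 <= eps ^- 2 by rewrite invf_ge1 // expr_le1 // ltW.
rewrite /rows -natr1; lra.
Qed.

End Precision.

Lemma bits_bound (p : nat) : exists C : R, 0 < C /\
  forall (eps : R) (n D : nat), 0 < eps -> eps < 1 -> (3 <= n)%N ->
  2 * ((precision eps D).+3 + expo_bits n p D)%:R * (rows eps)%:R
    <= C * (eps ^- 2 * (ln (ln n%:R) + ln (1 / eps) + ln D%:R)).
Proof.
have l2 := ln2_gt0; have mu := lnln3_gt0.
(* [C0] gathers the additive constants of [precision_le], [expo_bits_le] and the three extra bits.
   They are absorbed by [ln (ln n) >= ln (ln 3) > 0]; the 2 in [C1] is there because [ln D] occurs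
   in both bounds. *)
pose C0 : R := 6 * ln 2 + ln 121 + ln (2 / ln 2) + ln p.+1%:R.
pose C1 : R := (`|C0| / ln (ln 3) + 2) / ln 2.
have C1p : 0 < C1.
  rewrite divr_gt0 // ltr_wpDl // divr_ge0 //; exact: ltW.
exists (482 * C1); split=> [|eps n D eps0 eps1 n3]; first by rewrite mulr_gt0.
have hp := precision_le D eps0 eps1; have he := expo_bits_le p D n3.
have lne : 0 <= ln (1 / eps) by rewrite ln_ge0 // ler_pdivlMr // mul1r ltW.
have lnD := ln_nat_ge0 D.
have lnn : ln (ln 3) <= ln (ln n%:R) :> R.
  have n0 : 0 < ln n%:R :> R by apply: ln_gt0; rewrite ltr1n (leq_trans _ n3).
  rewrite ler_ln ?posrE //; last exact: lt_trans ln3_gt1.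
  by rewrite ler_ln ?posrE ?ltr0n ?ler_nat // (leq_trans _ n3).
set S := _ + _ + ln D%:R.
have CS : C0 <= `|C0| / ln (ln 3) * ln (ln n%:R).
  apply: le_trans (ler_norm C0) _; rewrite -mulrA ler_peMr //.
  by rewrite mulrC ler_pdivlMr // mul1r.
have S0 : 0 <= S by rewrite /S; lra.
have bits : ((precision eps D).+3 + expo_bits n p D)%:R <= C1 * S.
  have -> : ((precision eps D).+3 + expo_bits n p D)%:R =
      (precision eps D)%:R + 3 + (expo_bits n p D)%:R :> R.
    by rewrite -[_.+3]addn3 !natrD.
  move: hp he; move: (precision eps D)%:R (expo_bits n p D)%:R => P E hp he.
  rewrite /C1 mulrAC ler_pdivlMr // !mulrDl.
  have hS : `|C0| / ln (ln 3) * ln (ln n%:R) <= `|C0| / ln (ln 3) * S.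
    apply: ler_wpM2l; first by apply: divr_ge0 => //; exact: ltW.
    by move: lne lnD; rewrite /S; clear; lra.
  by move: hp he CS hS lnD lne lnn mu; rewrite /C0 /S; clear; lra.
have hr := rows_le eps0 eps1.
have -> : 482 * C1 * (eps ^- 2 * S) = 2 * ((C1 * S) * (241 * eps ^- 2)) by ring.
by rewrite -mulrA ler_pM2l // ler_pM.
Qed.

End Numerics.

(* With empty matrices the communication bound is 0, and since messages are
   nonempty no slot is allowed. *)
Lemma silent_protocol (R : realType) (n m M t1 t2 : nat) (G : rel 'I_m)
    (root : 'I_m) (eps : R) : (t1 + t2 = 0)%N ->
  exists P : protocol G ('M['I_M.+1]_(n, t1) * 'M['I_M.+1]_(n, t2)) 'M[R]_(t1, t2),
    (forall X Y, 3 / 4 <= uniform_prob R (fun w : (coins P).-tuple bool =>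
       frobenius (output_at (fun i => (X i, Y i)) w root
                  - (sum_inputs R X)^T *m sum_inputs R Y)
       <= eps * frobenius (sum_inputs R X) * frobenius (sum_inputs R Y))) /\
    (forall X Y (w : (coins P).-tuple bool), max_comm (fun i => (X i, Y i)) w = 0%N).
Proof.
move=> /eqP; rewrite addn_eq0 => /andP[/eqP t10 /eqP t20]; subst t1 t2.
have frob0 a (A : 'M[R]_(a, 0)) : frobenius A = 0.
  by rewrite /frobenius big1 ?sqrtr0 // => i _; rewrite big_ord0.
exists (@Protocol m G _ 'M[R]_(0, 0) 0 [::] (fun _ _ _ _ => [:: true])
  (fun _ _ _ => 0) isT (fun _ _ _ _ => isT)); split=> X Y; last first.
  by move=> w; apply: big1 => b _; rewrite /edge_bits /run big_nil.
have allw (E : pred (0.-tuple bool)) : (forall w, E w) -> uniform_prob R E = 1.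
  move=> Ew; rewrite /uniform_prob expr0 divr1 -[RHS]/(1%:R); congr _%:R.
  rewrite (eq_card (B := predT)); first by rewrite card_tuple expn0.
  by move=> w; rewrite !inE Ew.
rewrite allw; first lra.
by move=> w; rewrite !frob0 mulr0.
Qed.

Theorem theorem29 (R : realType) (c K : R) :
  exists C : R, 0 < C /\
  forall (eps : R) (n m M t1 t2 : nat) (G : rel 'I_m) (center : 'I_m),
    0 < eps -> eps < 1 ->
    (3 <= n)%N ->
    m%:R <= K * n%:R `^ c ->
    M%:R <= K * n%:R `^ c ->
    simple_graph G -> connected_graph G -> central G center ->
    exists P : protocol G ('M['I_M.+1]_(n, t1) * 'M['I_M.+1]_(n, t2)) 'M[R]_(t1, t2),
      (forall (X : 'I_m -> 'M['I_M.+1]_(n, t1)) (Y : 'I_m -> 'M['I_M.+1]_(n, t2)),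
         3 / 4 <= uniform_prob R (fun w : (coins P).-tuple bool =>
           frobenius (output_at (fun i => (X i, Y i)) w center
                      - (sum_inputs R X)^T *m sum_inputs R Y)
           <= eps * frobenius (sum_inputs R X) * frobenius (sum_inputs R Y))) /\
      (forall (X : 'I_m -> 'M['I_M.+1]_(n, t1)) (Y : 'I_m -> 'M['I_M.+1]_(n, t2))
              (w : (coins P).-tuple bool),
         (max_comm (fun i => (X i, Y i)) w)%:R
         <= C * (eps ^- 2 * (t1 + t2)%:R
                 * (ln (ln n%:R) + ln (1 / eps) + ln (diameter G)%:R))).
Proof.
(* [c] and [K] act only through the exponent [p], so [C] is fixed before [n] and the graph. *)
have [p hp] := poly_bound c K; have [C [C0 hC]] := bits_bound R p.
exists C; split=> // eps n m M t1 t2 G center eps0 eps1 n3 hm hM [Gs _] Gc _.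
have [t0|tpos] := posnP (t1 + t2)%N.
  have [P [accP commP]] := @silent_protocol R n m M t1 t2 G center eps t0.
  by exists P; split=> // X Y w; rewrite commP t0 mulr0 mul0r mulr0.
have mn := hp _ _ n3 hm; have Mn := hp _ _ n3 hM.
have m0 : (0 < m)%N := leq_ltn_trans (leq0n center) (ltn_ord center).
set D := diameter G; set s := precision eps D; set k := rows eps; set e := expo_bits n p D.
have lev_le v : (dist G center v <= D)%N by apply: dist_le_diameter.
have e_large := expo_bits_large D n3 m0 mn Mn.
have size_gt0 : (0 < k * (t1 + t2))%N by rewrite muln_gt0.
exists (sketch_protocol R n M center Gs Gc s e size_gt0); split=> X Y.
  apply: (accuracy Gs Gc lev_le e_large size_gt0 X Y eps0 eps1).
    exact: rows_ge.
  exact: growth_precision.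
move=> w; have := max_comm_sketch_protocol (Gs := Gs) (Gc := Gc) (R := R)
  (s := s) (e := e) (size_gt0 := size_gt0) lev_le X Y w.
rewrite -(ler_nat R) => /le_trans; apply.
have -> : (2 * message_bits t1 t2 k s e)%:R =
    2 * (s.+3 + e)%:R * k%:R * (t1 + t2)%:R :> R by rewrite !natrM !mulrA.
apply: le_trans (ler_wpM2r (ler0n _ _) (hC eps n D eps0 eps1 n3)) _.
by rewrite le_eqVlt; apply/orP; left; apply/eqP; ring.
Qed.
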